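(* For $n\in\mathbb N$ let $\sigma(n)$ denote the number of slim, semimodular diagrams of size $n$, counted up to similarity. There exists a constant $C$ with $0<C<1$ such that $$\lim_{n\to\infty}\frac{\sigma(n)}{2^n}=C .$$
   Context: A finite lattice $L$ is slim if the set of its join-irreducible elements contains no three-element antichain (equivalently, it is the union of two chains). A planar lattice diagram is a Hasse diagram of a finite lattice drawn in the plane without crossing edges. A slim, semimodular diagram is a planar diagram of a slim, (upper) semimodular finite lattice; its size is the number of elements of the lattice. Two planar lattice diagrams $D_1,D_2$ are similar if there is a bijection $\phi\colon D_1\to D_2$ that is a lattice isomorphism and preserves, for every element, the left-to-right order of its upper covers and the left-to-right order of its lower covers; similar diagrams are counted as equal. *)

(* Defs.v *)
From mathcomp Require Import all_boot.
From Stdlib Require Import Reals.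

Set Implicit Arguments.
Unset Strict Implicit.
Unset Printing Implicit Defensive.

Section Lat.
Variable n : nat.
Variable le : rel 'I_n.

Definition lt_ (x y : 'I_n) : Prop := le x y /\ x <> y.

Definition is_porder : Prop :=
  (forall x, le x x) /\
  (forall x y, le x y -> le y x -> x = y) /\
  (forall x y z, le x y -> le y z -> le x z).

Definition is_join (x y j : 'I_n) : Prop :=
  le x j /\ le y j /\ forall u, le x u -> le y u -> le j u.
Definition is_meet (x y m : 'I_n) : Prop :=
  le m x /\ le m y /\ forall u, le u x -> le u y -> le u m.

Definition is_lattice : Prop :=
  0 < n /\ is_porder /\
  (forall x y, exists j, is_join x y j) /\
  (forall x y, exists m, is_meet x y m).

Definition covers (x y : 'I_n) : Prop :=
  lt_ x y /\ ~ (exists z, lt_ x z /\ lt_ z y).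

Definition join_irr (x : 'I_n) : Prop :=
  (exists y, lt_ y x) /\ (forall y z, is_join y z x -> y = x \/ z = x).

Definition incomparable (x y : 'I_n) : Prop := ~~ le x y /\ ~~ le y x.

Definition slim : Prop :=
  ~ (exists x y z, join_irr x /\ join_irr y /\ join_irr z /\
       incomparable x y /\ incomparable x z /\ incomparable y z).

Definition semimodular : Prop :=
  forall a b m j, is_meet a b m -> is_join a b j -> covers m a -> covers b j.
End Lat.

Local Open Scope R_scope.

Definition pt := (R * R)%type.

Definition on_seg (p u v : pt) : Prop :=
  exists t, 0 <= t <= 1 /\
    fst p = fst u + t * (fst v - fst u) /\ snd p = snd u + t * (snd v - snd u).

Definition cross (a b c : pt) : R :=
  (fst b - fst a) * (snd c - snd a) - (snd b - snd a) * (fst c - fst a).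

Definition planar_diagram (n : nat) (le : rel 'I_n) (pos : 'I_n -> pt) : Prop :=
  injective pos /\
  (forall x y, covers le x y -> snd (pos x) < snd (pos y)) /\
  (forall v x y, covers le x y -> v <> x -> v <> y -> ~ on_seg (pos v) (pos x) (pos y)) /\
  (forall a b c d, covers le a b -> covers le c d ->
     a <> c -> a <> d -> b <> c -> b <> d ->
     ~ (exists p, on_seg p (pos a) (pos b) /\ on_seg p (pos c) (pos d))).

Record ssdiagram (n : nat) := SSDiagram {
  dle : rel 'I_n;
  dpos : 'I_n -> pt;
  d_lattice : is_lattice dle;
  d_slim : slim dle;
  d_semimod : semimodular dle;
  d_planar : planar_diagram dle dpos
}.

Definition up_left n (D : ssdiagram n) (a b c : 'I_n) : Prop :=
  covers (dle D) a b /\ covers (dle D) a c /\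
  cross (dpos D a) (dpos D b) (dpos D c) < 0.

Definition low_left n (D : ssdiagram n) (a b c : 'I_n) : Prop :=
  covers (dle D) b a /\ covers (dle D) c a /\
  cross (dpos D a) (dpos D b) (dpos D c) > 0.

Definition similar n (D1 D2 : ssdiagram n) : Prop :=
  exists phi : 'I_n -> 'I_n, bijective phi /\
    (forall x y, dle D1 x y = dle D2 (phi x) (phi y)) /\
    (forall a b c, up_left D1 a b c <-> up_left D2 (phi a) (phi b) (phi c)) /\
    (forall a b c, low_left D1 a b c <-> low_left D2 (phi a) (phi b) (phi c)).

Definition num_ssd_classes (n k : nat) : Prop :=
  exists D : 'I_k -> ssdiagram n,
    (forall i j, similar (D i) (D j) -> i = j) /\
    (forall E : ssdiagram n, exists i, similar E (D i)).

(* Main.v *)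
(* In a slim lattice an element has at most two upper covers; let lc x and rc x be the left
   and the right one (equal if there is only one). A path of covers leaving the interior of
   a cell upwards would cross its boundary, so by semimodularity lc (rc x) = rc (lc x)
   whenever lc x <> rc x. Consequently every element is rc^j (lc^i 0) for exactly one pair
   with i <= h and j < d_i, where h is the length and d_i - 1 is the first j such that
   rc^j (lc^i 0) has a single upper cover; the diagram is determined up to similarity by
   d_0, ..., d_{h-1}, and 1 <= d_i <= h - i, with sum n - 1. (The order of lower covers is
   forced as well: two paths of covers bounding a lens do not cross.)

   Conversely such a sequence is the Lehmer code of a permutation, whose lattice of unions
   of a prefix of (1, ..., h) with a prefix of the permutation embeds into N x N, and an
   order embedding of a lattice into the plane is a planar diagram.

   Hence sigma(n) counts the compositions of n - 1 whose t-th part is at most t. Building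
   compositions one unit at a time shows sigma(n + 1) <= 2 sigma(n) for n >= 2, so
   sigma(n) / 2^n converges, and a random composition satisfies the bounds with probability
   bounded away from 0. *)
Require Import Defs.
From mathcomp Require Import all_boot zify.
From Stdlib Require Import Reals Lra Lia Classical.

Set Implicit Arguments.
Unset Strict Implicit.
Unset Printing Implicit Defensive.

(** * Planarity *)

(** The truncation of [r] to the interval from 0 to 1, written with [Rabs] so that its continuity
    follows from that of the absolute value. *)
Definition ramp (r : R) : R := ((1 + Rabs r - Rabs (r - 1)) / 2)%R.

Lemma ramp_le0 r : (r <= 0)%R -> ramp r = 0%R.
Proof. by move=> h; rewrite /ramp !Rabs_left1; lra. Qed.

Lemma ramp_ge1 r : (1 <= r)%R -> ramp r = 1%R.
Proof. by move=> h; rewrite /ramp !Rabs_pos_eq; lra. Qed.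

Lemma ramp_id r : (0 <= r <= 1)%R -> ramp r = r.
Proof. by move=> h; rewrite /ramp Rabs_pos_eq ?Rabs_left1; lra. Qed.

Lemma ramp_continuity : continuity ramp.
Proof.
rewrite /ramp; apply: continuity_mult; last exact: continuity_const.
apply: continuity_minus.
  apply: continuity_plus; first exact: continuity_const.
  exact: Rcontinuity_abs.
apply: (continuity_comp (fun r => r - 1)%R Rabs); last exact: Rcontinuity_abs.
apply: continuity_minus; last exact: continuity_const.
by apply: derivable_continuous; apply: derivable_id.
Qed.

Local Open Scope R_scope.

Lemma Rdiv_le1 (a b : R) : 0 < b -> a <= b -> a / b <= 1.
Proof.
move=> b0 ab; apply: (Rmult_le_reg_r b) => //.
by rewrite /Rdiv Rmult_assoc Rinv_l; lra.
Qed.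

Lemma Rdiv_ge1 (a b : R) : 0 < b -> b <= a -> 1 <= a / b.
Proof.
move=> b0 ab; apply: (Rmult_le_reg_r b) => //.
by rewrite /Rdiv Rmult_assoc Rinv_l; lra.
Qed.

Lemma Rdiv_le0 (a b : R) : 0 < b -> a <= 0 -> a / b <= 0.
Proof.
move=> b0 ab; apply: (Rmult_le_reg_r b) => //.
by rewrite /Rdiv Rmult_assoc Rinv_l; lra.
Qed.

Lemma Rdiv_ge0 (a b : R) : 0 < b -> 0 <= a -> 0 <= a / b.
Proof.
move=> b0 ab; apply: (Rmult_le_reg_r b) => //.
by rewrite /Rdiv Rmult_assoc Rinv_l; lra.
Qed.

Lemma on_seg_sym p u v : on_seg p u v -> on_seg p v u.
Proof. case=> t [ht [h1 h2]]; exists (1 - t); split; first lra; split; lra. Qed.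

Lemma pt_eq (p q : pt) : fst p = fst q -> snd p = snd q -> p = q.
Proof. by case: p q => [a b] [c d] /= -> ->. Qed.

(** Two segments leaving [u] with a second common point have the same direction, so the end of the
    shorter one lies on the longer one; the quotient of the two parameters locates it. *)
Lemma on_seg_fork p u v w : on_seg p u v -> on_seg p u w -> p <> u ->
  on_seg v u w \/ on_seg w u v.
Proof.
case=> t1 [ht1 [h1 h1']] [t2 [ht2 [h2 h2']]] ne.
have t1p : 0 < t1.
  case: (Req_dec t1 0) => [e|]; last lra.
  by case: ne; apply: pt_eq; rewrite ?h1 ?h1' e; lra.
have t2p : 0 < t2.
  case: (Req_dec t2 0) => [e|]; last lra.
  by case: ne; apply: pt_eq; rewrite ?h2 ?h2' e; lra.
have e1 : t1 * (fst v - fst u) = t2 * (fst w - fst u) by lra.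
have e2 : t1 * (snd v - snd u) = t2 * (snd w - snd u) by lra.
case: (Rle_dec t2 t1) => h; [left; exists (t2 / t1) | right; exists (t1 / t2)].
  split; first split.
  - by apply: Rlt_le; apply: Rdiv_lt_0_compat.
  - by apply: Rdiv_le1; lra.
  - split; apply: (Rmult_eq_reg_l t1); try lra; field_simplify; lra.
split; first split.
- by apply: Rlt_le; apply: Rdiv_lt_0_compat.
- by apply: Rdiv_le1; lra.
- split; apply: (Rmult_eq_reg_l t2); try lra; field_simplify; lra.
Qed.

Lemma on_seg_snd p u v : snd u < snd v -> on_seg p u v ->
  snd u <= snd p <= snd v.
Proof. by move=> h [t [ht [_ ->]]]; split; nra. Qed.

Lemma on_seg_lo p u v : snd u < snd v -> on_seg p u v -> snd p <= snd u -> p = u.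
Proof.
move=> h [t [ht [h1 h2]]] h3; have t0 : t = 0 by nra.
by apply: pt_eq; rewrite ?h1 ?h2 t0; lra.
Qed.

Lemma on_seg_hi p u v : snd u < snd v -> on_seg p u v -> snd v <= snd p -> p = v.
Proof.
move=> h [t [ht [h1 h2]]] h3; have t0 : t = 1 by nra.
by apply: pt_eq; rewrite ?h1 ?h2 t0; lra.
Qed.

(** * Paths of covers as polygonal lines *)

Section Geometry.
Variables (n : nat) (le : rel 'I_n).

Definition coversb (x y : 'I_n) : bool :=
  [&& le x y, x != y &
      [forall z, ~~ [&& le x z, x != z, le z y & z != y]]].

Lemma coversP x y : reflect (covers le x y) (coversb x y).
Proof.
apply: (iffP and3P) => [[h1 /eqP h2 /forallP h3]|[[h1 h2] h3]].
  split=> // -[z [[xz nxz] [zy nzy]]].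
  by move: (h3 z); rewrite xz zy; move/eqP: nxz => ->; move/eqP: nzy => ->.
split=> //; first by apply/eqP.
apply/forallP=> z; apply/negP => /and4P [a /eqP b c /eqP d].
by apply: h3; exists z.
Qed.

Variable pos : 'I_n -> pt.
Hypothesis pl : planar_diagram le pos.

Local Notation X v := (fst (pos v)).
Local Notation Y v := (snd (pos v)).

Lemma coversb_lt x y : coversb x y -> Y x < Y y.
Proof. by case: pl => _ [h _] /coversP; apply: h. Qed.

(** [planar_diagram] forbids crossings only for edges with four distinct ends. For a shared lower or
    upper end, a second common point would by [on_seg_fork] put a vertex on a foreign edge; if the
    top of one edge is the bottom of the other, the heights leave only that vertex. *)
Lemma edge_meet a b c d p : coversb a b -> coversb c d ->
  on_seg p (pos a) (pos b) -> on_seg p (pos c) (pos d) ->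
  (a = c /\ b = d) \/
  exists v, p = pos v /\ (v = a \/ v = b) /\ (v = c \/ v = d).
Proof.
move=> ab cd pab pcd.
have [inj [_ [von nocr]]] := pl.
have yab := coversb_lt ab; have ycd := coversb_lt cd.
have nfork (u v w : 'I_n) q : coversb u v -> coversb u w -> v <> w ->
    on_seg q (pos u) (pos v) -> on_seg q (pos u) (pos w) -> q = pos u.
  move=> uv uw nvw q1 q2; apply: NNPP => ne.
  have ruv := coversb_lt uv; have ruw := coversb_lt uw.
  have nvu : v <> u by move=> e; rewrite e in ruv; lra.
  have nwu : w <> u by move=> e; rewrite e in ruw; lra.
  case: (on_seg_fork q1 q2 ne).
    by move/coversP: uw => uw; apply: von uw _ nvw.
  by move/coversP: uv => uv; apply: von uv _ (not_eq_sym nvw).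
have njoin (u v w : 'I_n) q : coversb u v -> coversb w v -> u <> w ->
    on_seg q (pos u) (pos v) -> on_seg q (pos w) (pos v) -> q = pos v.
  move=> uv wv nuw /on_seg_sym q1 /on_seg_sym q2; apply: NNPP => ne.
  have ruv := coversb_lt uv; have rwv := coversb_lt wv.
  have nuv : u <> v by move=> e; rewrite e in ruv; lra.
  have nwv : w <> v by move=> e; rewrite e in rwv; lra.
  case: (on_seg_fork q1 q2 ne) => /on_seg_sym.
    by move/coversP: wv => wv; apply: von wv nuw nuv.
  by move/coversP: uv => uv; apply: von uv (not_eq_sym nuw) nwv.
case: (eqVneq a c) => [e|nac].
  subst c; case: (eqVneq b d) => [e|/eqP nbd]; first by left.
  by right; exists a; split; [apply: (nfork a b d) | split; left].
case: (eqVneq b d) => [e|nbd].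
  subst d; right; exists b; split; last by split; right.
  by apply: (njoin a b c) => //; apply/eqP.
case: (eqVneq a d) => [e|nad].
  subst d; right; exists a; split; last by split; [left|right].
  apply: (on_seg_lo yab pab); have := on_seg_snd ycd pcd; lra.
case: (eqVneq b c) => [e|nbc].
  subst c; right; exists b; split; last by split; [right|left].
  apply: (on_seg_hi yab pab); have := on_seg_snd ycd pcd; lra.
case: (nocr a b c d).
- exact/coversP.
- exact/coversP.
- exact/eqP.
- exact/eqP.
- exact/eqP.
- exact/eqP.
- by exists p.
Qed.

(* The abscissa at height [t] of the polygonal line through [x :: p], as a sum of ramps so
   that it is continuous on the whole of [R]. *)
Fixpoint absc (x : 'I_n) (p : seq 'I_n) (t : R) : R :=
  if p is y :: p' then
    absc y p' t + (X x - X y) * (1 - ramp ((t - Y x) / (Y y - Y x)))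
  else X x.

Lemma absc_continuity x p : continuity (absc x p).
Proof.
elim: p x => [|y p IH] x /=; first exact: continuity_const.
apply: continuity_plus; first exact: IH.
apply: continuity_mult; first exact: continuity_const.
apply: continuity_minus; first exact: continuity_const.
apply: (continuity_comp (fun t => (t - Y x) / (Y y - Y x)) ramp);
  last exact: ramp_continuity.
apply: continuity_mult; last exact: continuity_const.
apply: continuity_minus; last exact: continuity_const.
by apply: derivable_continuous; apply: derivable_id.
Qed.

Lemma absc_low x p t : path coversb x p -> t <= Y x -> absc x p t = X x.
Proof.
elim: p x => [|y p IH] x //= /andP [xy yp] ht.
have h := coversb_lt xy; rewrite IH //; last lra.
rewrite ramp_le0; first lra.
by apply: Rdiv_le0; lra.
Qed.

Lemma absc_first x y p t : path coversb x (y :: p) -> Y x <= t <= Y y ->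
  absc x (y :: p) t = X x + (t - Y x) / (Y y - Y x) * (X y - X x).
Proof.
move=> /= /andP [xy yp] ht; have h := coversb_lt xy.
rewrite absc_low //; last lra.
rewrite ramp_id; first lra.
split; first by apply: Rdiv_ge0; lra.
by apply: Rdiv_le1; lra.
Qed.

Lemma absc_next x y p t : coversb x y -> Y y <= t -> absc x (y :: p) t = absc y p t.
Proof.
move=> xy ht /=; have h := coversb_lt xy; rewrite ramp_ge1; first lra.
by apply: Rdiv_ge1; lra.
Qed.

Lemma absc_top x p : path coversb x p -> absc x p (Y (last x p)) = X (last x p).
Proof.
elim: p x => [|y p IH] x //= /andP [xy yp].
suff h : Y y <= Y (last y p) by rewrite -[LHS]/(absc x (y :: p) _) absc_next // IH.
elim: p y yp {xy IH} => [|z p IH] y /=; first by move=> _; lra.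
by move=> /andP [/coversb_lt yz zp]; have := IH _ zp; lra.
Qed.

Lemma absc_on_seg x p t : path coversb x p -> p != [::] ->
  Y x <= t <= Y (last x p) ->
  exists a b, a \in x :: p /\ b \in x :: p /\ coversb a b /\
    on_seg (absc x p t, t) (pos a) (pos b).
Proof.
elim: p x => [|y p IH] x //= /andP [xy yp] _ ht.
have h := coversb_lt xy.
case: (Rle_dec t (Y y)) => ty.
  exists x, y; rewrite !inE !eqxx orbT; split=> //; split=> //; split=> //.
  have {}ht : Y x <= t <= Y y by lra.
  exists ((t - Y x) / (Y y - Y x)); split.
    by split; [apply: Rdiv_ge0|apply: Rdiv_le1]; lra.
  rewrite -[absc y p t + _]/(absc x (y :: p) t) absc_first //= ?xy //.
  by split; [lra | field; lra].
case: p yp IH ht => [|z p] yp IH ht; first by move: ht => /=; lra.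
have [|a [b [ha [hb [ab ov]]]]] := IH y yp isT; first by lra.
exists a, b; rewrite inE ha orbT inE hb orbT; split=> //; split=> //; split=> //.
rewrite -[_ + _]/(absc x [:: y, z & p] t) absc_next //; lra.
Qed.

(** Equal abscissas give a common point of an edge of each path. By [edge_meet] it is a shared
    vertex, the case [v = w], or lies on a shared edge, the case [coversb v w]. *)
Lemma absc_meet x p y q t : path coversb x p -> path coversb y q ->
  p != [::] -> q != [::] ->
  Y x <= t <= Y (last x p) -> Y y <= t <= Y (last y q) ->
  absc x p t = absc y q t ->
  exists v w, [/\ v \in x :: p, v \in y :: q, w \in x :: p, w \in y :: q &
     (v = w \/ coversb v w)] /\ Y v <= t <= Y w.
Proof.
move=> xp yq p0 q0 tp tq e.
have [a [b [ha [hb [ab pab]]]]] := absc_on_seg xp p0 tp.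
have [c [d [hc [hd [cd pcd]]]]] := absc_on_seg yq q0 tq.
rewrite -e in pcd.
case: (edge_meet ab cd pab pcd) => [[eac ebd]|[v [pv [v1 v2]]]].
  subst c d; exists a, b; split; first by split=> //; right.
  have := on_seg_snd (coversb_lt ab) pab; by rewrite /=.
have hv : Y v = t by rewrite -pv.
exists v, v; split; last by lra.
by split; rewrite //; try (by left);
  [case: v1 | case: v2 | case: v1 | case: v2] => ->.
Qed.

(** The intermediate value theorem applied to the difference; it asks for continuity on all of
    [R]. *)
Lemma absc_separated x p y q s t : s <= t ->
  (forall z, s <= z <= t -> absc x p z <> absc y q z) ->
  absc x p s < absc y q s -> absc x p t < absc y q t.
Proof.
move=> st nz hs; apply: Rnot_le_lt => /Rle_lt_or_eq_dec [ht|ht]; last first.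
  by apply: (nz t); [lra|].
have cont : continuity (fun z => absc x p z - absc y q z).
  by apply: continuity_minus; apply: absc_continuity.
have st' : s < t by case: (Req_dec s t) => [e|]; [subst t|]; lra.
have [||z [hz e]] := IVT _ s t cont st'; try lra.
by apply: (nz z hz); lra.
Qed.

(** At the lower of the two heights both lines are still on their first edges, and the sign of
    [cross] tells which edge leans further left. *)
Lemma absc_fork a b c p q : path coversb a (b :: p) -> path coversb a (c :: q) ->
  cross (pos a) (pos b) (pos c) < 0 ->
  absc a (b :: p) (Rmin (Y b) (Y c)) < absc a (c :: q) (Rmin (Y b) (Y c)).
Proof.
move=> abp acq cr.
have /andP [/coversb_lt hb _] := abp; have /andP [/coversb_lt hc _] := acq.
set t := Rmin _ _.
have tb : t <= Y b by apply: Rmin_l.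
have tc : t <= Y c by apply: Rmin_r.
have ta : Y a < t by apply: Rmin_glb_lt.
rewrite !absc_first //; try lra.
move: cr; rewrite /cross => cr.
apply: Rplus_lt_compat_l.
have e1 : (t - Y a) / (Y b - Y a) * (X b - X a) =
  (t - Y a) / ((Y b - Y a) * (Y c - Y a)) * ((X b - X a) * (Y c - Y a)).
  by field; lra.
have e2 : (t - Y a) / (Y c - Y a) * (X c - X a) =
  (t - Y a) / ((Y b - Y a) * (Y c - Y a)) * ((X c - X a) * (Y b - Y a)).
  by field; lra.
rewrite e1 e2; apply: Rmult_lt_compat_l; last lra.
by apply: Rdiv_lt_0_compat; [lra | apply: Rmult_lt_0_compat; lra].
Qed.

Lemma absc_last x p d t : path (coversb) x (rcons p d) ->
  Y (last x p) <= t -> absc x (rcons p d) t = absc (last x p) [:: d] t.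
Proof.
elim: p x => [|y p IH] x //.
rewrite rcons_cons [path _ _ _]/=; move=> /andP [xy yp] ht.
rewrite absc_next //; first by apply: IH.
apply: Rle_trans ht; move: yp; rewrite rcons_path => /andP [yp _] /=.
elim: p y yp {xy IH} => [|z p IH] y /=; first by move=> _; lra.
by move=> /andP [/coversb_lt yz zp]; have := IH _ zp; lra.
Qed.

Lemma absc_join a p q d : path coversb a (rcons p d) -> path coversb a (rcons q d) ->
  let y := last a p in let z := last a q in
  cross (pos d) (pos y) (pos z) < 0 ->
  absc a (rcons q d) (Rmax (Y y) (Y z)) < absc a (rcons p d) (Rmax (Y y) (Y z)).
Proof.
move=> ap aq y z cr.
have := ap; rewrite rcons_path -/y => /andP [_ yd].
have := aq; rewrite rcons_path -/z => /andP [_ zd].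
have hy := coversb_lt yd; have hz := coversb_lt zd.
set t := Rmax _ _.
have ty : Y y <= t by apply: Rmax_l.
have tz : Y z <= t by apply: Rmax_r.
have td : t < Y d by apply: Rmax_lub_lt.
rewrite (absc_last ap ty) (absc_last aq tz) -/y -/z.
rewrite !absc_first /= ?yd ?zd //; try lra.
move: cr; rewrite /cross => cr.
have e1 : X y + (t - Y y) / (Y d - Y y) * (X d - X y) =
  X d + (Y d - t) / ((Y d - Y y) * (Y d - Y z)) * ((X y - X d) * (Y d - Y z)).
  by field; lra.
have e2 : X z + (t - Y z) / (Y d - Y z) * (X d - X z) =
  X d + (Y d - t) / ((Y d - Y y) * (Y d - Y z)) * ((X z - X d) * (Y d - Y y)).
  by field; lra.
rewrite e1 e2; apply: Rplus_lt_compat_l; apply: Rmult_lt_compat_l; last lra.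
by apply: Rdiv_lt_0_compat; [lra | apply: Rmult_lt_0_compat; lra].
Qed.

Lemma cross_upper_neq0 a b c : coversb a b -> coversb a c -> b <> c ->
  cross (pos a) (pos b) (pos c) <> 0.
Proof.
move=> ab ac bc; have hb := coversb_lt ab; have hc := coversb_lt ac.
rewrite /cross => e; have [_ [_ [von _]]] := pl.
case: (Rle_dec (Y b) (Y c)) => h.
  apply: (von b a c).
  - exact/coversP.
  - by move=> e'; rewrite e' in hb; lra.
  - by [].
  exists ((Y b - Y a) / (Y c - Y a)); split.
    by split; [apply: Rdiv_ge0 | apply: Rdiv_le1]; lra.
  split; last by field; lra.
  by apply: (Rmult_eq_reg_r (Y c - Y a)); try lra; field_simplify; lra.
apply: (von c a b).
- exact/coversP.
- by move=> e'; rewrite e' in hc; lra.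
- by move=> e'; apply: bc.
exists ((Y c - Y a) / (Y b - Y a)); split.
  by split; [apply: Rdiv_ge0 | apply: Rdiv_le1]; lra.
split; last by field; lra.
by apply: (Rmult_eq_reg_r (Y b - Y a)); try lra; field_simplify; lra.
Qed.

Lemma cross_lower_neq0 a b c : coversb b a -> coversb c a -> b <> c ->
  cross (pos a) (pos b) (pos c) <> 0.
Proof.
move=> ab ac bc; have hb := coversb_lt ab; have hc := coversb_lt ac.
rewrite /cross => e; have [_ [_ [von _]]] := pl.
case: (Rle_dec (Y c) (Y b)) => h.
  apply: (von b c a).
  - exact/coversP.
  - by [].
  - by move=> e'; rewrite e' in hb; lra.
  exists ((Y b - Y c) / (Y a - Y c)); split.
    by split; [apply: Rdiv_ge0 | apply: Rdiv_le1]; lra.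
  split; last by field; lra.
  by apply: (Rmult_eq_reg_r (Y a - Y c)); try lra; field_simplify; lra.
apply: (von c b a).
- exact/coversP.
- by move=> e'; apply: bc.
- by move=> e'; rewrite e' in hc; lra.
exists ((Y c - Y b) / (Y a - Y b)); split.
  by split; [apply: Rdiv_ge0 | apply: Rdiv_le1]; lra.
split; last by field; lra.
by apply: (Rmult_eq_reg_r (Y a - Y b)); try lra; field_simplify; lra.
Qed.

Hypothesis po : is_porder le.

(** By induction on the size of the interval, which is split at an element strictly between [x] and
    [y] unless [y] covers [x]. *)
Lemma cover_path x y : le x y -> exists p,
  [/\ path coversb x p, last x p = y & forall z, z \in x :: p -> le x z && le z y].
Proof.
have [refl [anti trans]] := po.
move: {2}_.+1 (ltnSn #|[set z | le x z && le z y]|) => k.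
elim: k x y => // k IH x y hk xy.
case: (eqVneq x y) => [e|nxy].
  by subst y; exists [::]; split=> // z; rewrite inE => /eqP ->; rewrite refl.
case: (boolP (coversb x y)) => [cxy|].
  exists [:: y]; split=> //=; first by rewrite cxy.
  by move=> z; rewrite !inE => /orP [] /eqP ->; rewrite ?refl ?xy.
rewrite /coversb xy nxy /= => /forallPn [z]; rewrite negbK => /and4P [xz nxz zy nzy].
have sub1 : [set v | le x v && le v z] \proper [set v | le x v && le v y].
  apply/properP; split; first apply/subsetP=> v; rewrite ?inE.
    by move=> /andP [-> vz]; apply: trans vz zy.
  exists y; rewrite inE ?xy ?refl //; apply: contraNN nzy => /andP [_ yz].
  by apply/eqP; apply: anti.
have sub2 : [set v | le z v && le v y] \proper [set v | le x v && le v y].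
  apply/properP; split; first apply/subsetP=> v; rewrite ?inE.
    by move=> /andP [zv ->]; rewrite (trans _ _ _ xz zv).
  exists x; rewrite inE ?xy ?refl //; apply: contraNN nxz => /andP [zx _].
  by apply/eqP; apply: anti.
have [p [pp lp ap]] := IH x z (leq_trans (proper_card sub1) hk) xz.
have [q [pq lq aq]] := IH z y (leq_trans (proper_card sub2) hk) zy.
exists (p ++ q); rewrite cat_path last_cat lp pp; split=> // v.
rewrite -cat_cons mem_cat => /orP [/ap /andP [-> vz]|vq]; first exact: trans vz zy.
have /aq /andP [zv ->] : v \in z :: q by rewrite inE vq orbT.
by rewrite (trans _ _ _ xz zv).
Qed.

Lemma coversb_le x y : coversb x y -> le x y.
Proof. by case/and3P. Qed.

Lemma le_height x y : le x y -> x <> y -> Y x < Y y.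
Proof.
move=> xy; have [p [pp <- _]] := cover_path xy => {xy}.
elim: p x pp => [|z p IH] x //= /andP [/coversb_lt xz zp] _.
by case: (eqVneq z (last z p)) => [<- //|/eqP/(IH _ zp)]; lra.
Qed.

(* A path leaving [c] between the edges [c b] and [c d] of a cell could not escape
   the cell without meeting its boundary. *)
Lemma cell_empty_above_right x b c d w u :
  coversb x b -> coversb x c -> coversb b d -> coversb c d -> coversb c w ->
  b <> c -> ~~ le w d -> le w u -> le d u ->
  cross (pos x) (pos b) (pos c) < 0 -> ~ cross (pos c) (pos w) (pos d) < 0.
Proof.
have [refl [anti trans]] := po.
move=> xb xc bd cd cw nbc nwd wu du crx crc.
have hxb := coversb_lt xb; have hxc := coversb_lt xc; have hbd := coversb_lt bd.
have hcd := coversb_lt cd; have hcw := coversb_lt cw.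
have [q [pq lq aq]] := cover_path wu.
have hdu : Y d < Y u.
  by apply: le_height => // e; rewrite -e in wu; rewrite wu in nwd.
have hwu : Y w <= Y u.
  by case: (eqVneq w u) => [->|/eqP]; [lra | move/(le_height wu); lra].
have pP : path coversb x [:: b; d] by rewrite /= xb bd.
have pR : path coversb x [:: c] by rewrite /= xc.
have pS : path coversb c [:: d] by rewrite /= cd.
have pQ : path coversb c (w :: q) by rewrite /= cw.
(* At the height of [c], the left side [x, b, d] of the cell is still to the left of [c]. *)
have s1 : absc x [:: b; d] (Y c) < X c.
  rewrite -[X c]/(X (last x [:: c])) -(absc_top pR).
  have := absc_fork pP pR crx; set t := Rmin _ _ => ht.
  have tx : Y x < t by apply: Rmin_glb_lt.
  have tc : t <= Y c by apply: Rmin_r.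
  apply: absc_separated ht => //= z hz /(absc_meet pP pR) [] //=; try lra.
  move=> v [w' [[_ _ w1 w2 _] hw]].
  have e : w' = x.
    move: w1 w2; rewrite !inE => w1 /orP [/eqP//|/eqP e]; subst w'.
    case/or3P: w1 => /eqP // e; first by rewrite e in nbc.
    by rewrite e in hcd; lra.
  by rewrite e in hw; lra.
(* The path from [c] through [w] cannot meet the left side, since a common vertex would put [w]
   below [d]. So it passes to the right of [d]. *)
have s2 : X d < absc c (w :: q) (Y d).
  rewrite -[X d]/(X (last x [:: b; d])) -(absc_top pP) [last _ _]/=.
  apply: (@absc_separated _ _ _ _ (Y c)); first lra; last first.
    by rewrite [absc c _ _]absc_low //; lra.
  move=> z hz /(absc_meet pP pQ) [] //; rewrite ?[last _ _]/= ?lq; try lra.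
  move=> v [_ [[v1 v2 _ _ _] _]]; apply/negP: nwd; rewrite negbK.
  have vd : le v d.
    move: v1; rewrite !inE => /or3P [] /eqP -> //; try exact: coversb_le.
    by apply: trans (coversb_le bd); apply: coversb_le.
  move: v2; rewrite inE => /orP [/eqP e|/aq /andP [wv _]]; last exact: trans vd.
  subst v; exfalso; move: v1; rewrite !inE => /or3P [] /eqP e.
  - by rewrite e in hxc; lra.
  - by rewrite e in nbc.
  - by rewrite e in hcd; lra.
(* It starts to the left of the edge from [c] to [d] and cannot meet that edge again, so it also
   passes to the left of [d]. *)
have s3 : absc c (w :: q) (Y d) < X d.
  rewrite -[X d]/(X (last c [:: d])) -(absc_top pS) [last _ _]/=.
  have := absc_fork pQ pS crc; set t := Rmin _ _ => ht.
  have tx : Y c < t by apply: Rmin_glb_lt.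
  have tc : t <= Y d by apply: Rmin_r.
  apply: absc_separated ht => // z hz /(absc_meet pQ pS) []; rewrite //= ?lq; try lra.
  move=> v [w' [[_ _ w1 w2 _] hw]].
  have e : w' = c.
    move: w1 w2; rewrite inE => w1; rewrite !inE => /orP [/eqP //|/eqP e].
    subst w'; case/orP: w1 => [/eqP // | /aq /andP [wd _]].
    by rewrite wd in nwd.
  by rewrite e in hw; lra.
lra.
Qed.

(** The paths from [a] to [d] through [b], [y] and through [c], [z] share only their ends, as a
    common inner element is below [y] and [z], hence below [a]. So they keep their order, and the
    one that leaves [a] on the left reaches [d] from the left. *)
Lemma lens_orientation a b c d y z :
  coversb a b -> coversb a c -> coversb y d -> coversb z d -> le b y -> le c z ->
  y <> z -> (forall v, le v y -> le v z -> le v a) ->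
  cross (pos a) (pos b) (pos c) < 0 -> ~ cross (pos d) (pos y) (pos z) < 0.
Proof.
have [refl [anti trans]] := po.
move=> ab ac yd zd bY cz nyz meet cra crd.
have [p [pp lp ap]] := cover_path bY.
have [q [pq lq aq]] := cover_path cz.
(* [absc_meet] also allows a shared edge, which here could only join [a] to [d]. *)
have nad : ~~ coversb a d.
  apply/negP => /coversP [_ []]; exists b.
  move/coversP: ab => [ab _]; split=> //; split.
    by apply: trans bY (coversb_le yd).
  move=> e; rewrite e in bY; have := coversb_lt yd.
  by rewrite (anti _ _ (coversb_le yd) bY); lra.
have hab := coversb_lt ab; have hac := coversb_lt ac.
have hyd := coversb_lt yd; have hzd := coversb_lt zd.
have hby : Y b <= Y y.
  by case: (eqVneq b y) => [->|/eqP]; [lra | move/(le_height bY); lra].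
have hcz : Y c <= Y z.
  by case: (eqVneq c z) => [->|/eqP]; [lra | move/(le_height cz); lra].
have pP : path coversb a (rcons (b :: p) d).
  by rewrite rcons_path /= ab pp lp.
have pQ : path coversb a (rcons (c :: q) d).
  by rewrite rcons_path /= ac pq lq.
have lP : last a (rcons (b :: p) d) = d by rewrite last_rcons.
have lQ : last a (rcons (c :: q) d) = d by rewrite last_rcons.
have := absc_fork pP pQ cra; set t0 := Rmin _ _ => h0.
have t0a : Y a < t0 by apply: Rmin_glb_lt.
have t0b : t0 <= Y b by apply: Rmin_l.
have := @absc_join a (b :: p) (c :: q) d pP pQ.
rewrite /= lp lq => /(_ crd); set t1 := Rmax _ _ => h1.
have t1d : t1 < Y d by apply: Rmax_lub_lt.
have t1y : Y y <= t1 by apply: Rmax_l.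
suff : absc a (rcons (b :: p) d) t1 < absc a (rcons (c :: q) d) t1.
  by move=> h2; apply: (Rlt_irrefl _ (Rlt_trans _ _ _ h2 h1)).
apply: absc_separated h0; first lra.
move=> t ht /(absc_meet pP pQ) []; rewrite ?lP ?lQ //; try lra.
have common v : v \in a :: rcons (b :: p) d -> v \in a :: rcons (c :: q) d ->
    v = a \/ v = d.
  rewrite inE mem_rcons inE => h; rewrite inE mem_rcons inE.
  case/or3P: h => [/eqP|/eqP|/ap /andP [bv vy]]; [by left|by right|].
  case/or3P=> [/eqP|/eqP|/aq /andP [cv vz]]; [by left|by right|].
  have := coversb_lt ab; have va := meet _ vy vz.
  have -> : a = b; last lra.
  by apply: anti; [apply: coversb_le | apply: trans bv va].
move=> v [w [[v1 v2 w1 w2 vw] hvw]].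
case: (common _ v1 v2) => ev; last by rewrite ev in hvw; lra.
case: (common _ w1 w2) => ew; first by rewrite ew in hvw; lra.
case: vw => [e|]; last by rewrite ev ew => h; rewrite h in nad.
by rewrite -e ev in ew; rewrite -ew in hvw t1d; lra.
Qed.

End Geometry.

Lemma planar_mirror n (le : rel 'I_n) (pos : 'I_n -> pt) :
  planar_diagram le pos ->
  planar_diagram le (fun v => (- fst (pos v), snd (pos v))).
Proof.
have seg p u v : on_seg p (- fst u, snd u) (- fst v, snd v) ->
    on_seg (- fst p, snd p) u v.
  move=> [t [ht /= [h1 h2]]]; exists t; split=> //=; split=> //; lra.
case=> [inj [mono [von nocr]]]; split; [|split; [|split]].
- move=> x y [h1 h2]; apply: inj; apply: pt_eq => //; lra.
- exact: mono.
- move=> v x y xy vx vy /seg /= h; apply: (von v x y xy vx vy).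
  by move: h; rewrite Ropp_involutive; case: (pos v).
- move=> a b c d ab cd h1 h2 h3 h4 [p [p1 p2]].
  by apply: (nocr a b c d ab cd h1 h2 h3 h4); exists (- fst p, snd p); split; apply: seg.
Qed.

Lemma cell_empty_above_left n (le : rel 'I_n) (pos : 'I_n -> pt) x b c d w u :
  planar_diagram le pos -> is_porder le ->
  coversb le x b -> coversb le x c -> coversb le b d -> coversb le c d ->
  coversb le b w -> b <> c -> ~~ le w d -> le w u -> le d u ->
  cross (pos x) (pos b) (pos c) < 0 -> ~ cross (pos b) (pos d) (pos w) < 0.
Proof.
move=> /planar_mirror pl po xb xc bd cd bw nbc nwd wu du crx cr.
apply: (@cell_empty_above_right _ _ _ pl po x c b d w u) => //.
- exact: not_eq_sym.
- by move: crx; rewrite /cross /=; lra.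
- by move: cr; rewrite /cross /=; lra.
Qed.

Local Close Scope R_scope.

(** * Leftmost and rightmost covers *)

Section Poset.
Variables (n : nat) (le : rel 'I_n).
Hypothesis po : is_porder le.

Lemma po_refl x : le x x. Proof. by case: po. Qed.
Lemma po_anti x y : le x y -> le y x -> x = y. Proof. by case: po => _ []; auto. Qed.
Lemma po_trans x y z : le x y -> le y z -> le x z.
Proof. by case: po => _ [_]; apply. Qed.

Lemma coversb_neq x y : coversb le x y -> x <> y.
Proof. by case/and3P => _ /eqP. Qed.

Lemma coversb_between x y z : coversb le x y -> le x z -> le z y -> z = x \/ z = y.
Proof.
move=> /and3P [_ _ /forallP /(_ z)]; case: (eqVneq x z) => [->|nxz]; first by left.
case: (eqVneq z y) => [->|nzy]; first by right.
by move=> /= h xz zy; move: h; rewrite xz zy.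
Qed.

Lemma coversb_le_eq x y z : coversb le x y -> coversb le x z -> le y z -> y = z.
Proof.
move=> xy xz yz; case: (coversb_between xz (coversb_le xy) yz) => // e.
by case: (coversb_neq xy).
Qed.

Lemma lower_coversb_le_eq x y z : coversb le y x -> coversb le z x -> le y z -> y = z.
Proof.
move=> xy xz yz; case: (coversb_between xy yz (coversb_le xz)) => // e.
by case: (coversb_neq xz).
Qed.

Lemma upper_cover_below x y : le x y -> x <> y -> exists2 c, coversb le x c & le c y.
Proof.
move=> xy nxy; have [[|c p] [/= pp lp ap]] := cover_path po xy; first by case: nxy.
move: pp => /andP [xc _]; exists c => //.
by have /andP [] : le x c && le c y by apply: ap; rewrite !inE eqxx orbT.
Qed.

Lemma lower_cover_above x y : le x y -> x <> y -> exists2 c, coversb le c y & le x c.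
Proof.
move=> xy nxy; have [p [pp lp ap]] := cover_path po xy.
case/lastP: p pp lp ap => [|p c] /=; first by move=> _ e; case: nxy.
rewrite rcons_path last_rcons => /andP [_ cy] e ap; subst c.
exists (last x p) => //.
have /andP [] // : le x (last x p) && le (last x p) y.
by apply: ap; rewrite -rcons_cons mem_rcons inE mem_last orbT.
Qed.

End Poset.

(** For a common lower bound [u] of [b] and [c], the join of [x] and [u] lies between [x] and either
    cover, hence equals [x]. *)
Lemma coversb_meet n (le : rel 'I_n) x b c : is_lattice le ->
  coversb le x b -> coversb le x c -> b <> c -> is_meet le b c x.
Proof.
move=> [_ [po [jn _]]] xb xc nbc.
split; [exact: coversb_le | split; [exact: coversb_le|]] => u ub uc.
have [j [xj [uj hj]]] := jn x u.
have jb : le j b by apply: hj => //; apply: coversb_le.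
have jc : le j c by apply: hj => //; apply: coversb_le.
case: (coversb_between xb xj jb) => e; first by rewrite -e.
by case: nbc; apply: (coversb_le_eq xb xc); rewrite -e.
Qed.

Lemma lattice_top n (le : rel 'I_n) : is_lattice le -> exists u, forall x, le x u.
Proof.
move=> [n0 [po [jn _]]].
pose f (x : 'I_n) := #|[set z | le z x]|.
have [u _ hu] := @arg_maxnP _ (Ordinal n0) xpredT f isT.
exists u => x; have [j [xj [uj _]]] := jn x u.
suff -> : u = j by [].
apply/eqP; apply: contraT => nuj.
have := hu j isT; rewrite /geq /= leqNgt => /negP; case.
apply: proper_card; apply/properP; split.
  by apply/subsetP=> z; rewrite !inE => zu; apply: (po_trans po) zu uj.
exists j; rewrite inE ?po_refl //; apply: contraNN nuj => ju.
by apply/eqP; apply: (po_anti po) ju.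
Qed.

Lemma lattice_bot n (le : rel 'I_n) : is_lattice le -> exists u, forall x, le u x.
Proof.
move=> [n0 [po [_ mt]]].
pose f (x : 'I_n) := #|[set z | le x z]|.
have [u _ hu] := @arg_maxnP _ (Ordinal n0) xpredT f isT.
exists u => x; have [j [jx [ju _]]] := mt x u.
suff -> : u = j by [].
apply/eqP; apply: contraT => nuj.
have := hu j isT; rewrite /geq /= leqNgt => /negP; case.
apply: proper_card; apply/properP; split.
  by apply/subsetP=> z; rewrite !inE => zu; apply: (po_trans po) ju zu.
exists j; rewrite inE ?po_refl //; apply: contraNN nuj => uj.
by apply/eqP; apply: (po_anti po uj).
Qed.

(* A minimal element of [{z | z <= c, ~ z <= x}] is join-irreducible. *)
Lemma join_irr_below_cover n (le : rel 'I_n) x c : is_lattice le -> coversb le x c ->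
  exists p, [/\ join_irr le p, le p c & ~~ le p x].
Proof.
move=> lat xc; have [_ [po _]] := lat.
pose P z := le z c && ~~ le z x.
have Pc : P c.
  rewrite /P po_refl //=; apply/negP => cx.
  by apply: (coversb_neq xc); apply: (po_anti po) => //; apply: coversb_le.
have [p /andP [pc npx] hp] := @arg_minnP _ c P (fun z => #|[set v | le v z]|) Pc.
exists p; split=> //; split.
  have [o ho] := lattice_bot lat; exists o; split=> // e.
  by rewrite -e ho in npx.
have below y : le y p -> y <> p -> le y x.
  move=> yp nyp; apply: contraT => nyx.
  have Py : P y by rewrite /P nyx (po_trans po yp pc).
  have := hp _ Py; rewrite leqNgt => /negP; case; apply: proper_card.
  apply/properP; split.
    by apply/subsetP=> v; rewrite !inE => vy; apply: (po_trans po) vy yp.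
  exists p; rewrite inE ?po_refl //; apply/negP => py.
  by apply: nyp; apply: (po_anti po).
move=> y z [yp [zp hyz]]; case: (eqVneq y p) => [->|/eqP ny]; first by left.
right; apply: NNPP => nz; move/negP: npx; apply.
by apply: hyz; apply: below.
Qed.

(** Below each cover there is a join-irreducible element not below [x]. As two distinct covers meet
    in [x], three such elements would form an antichain. *)
Lemma slim_upper_covers n (le : rel 'I_n) x a b c : is_lattice le -> slim le ->
  coversb le x a -> coversb le x b -> coversb le x c -> a <> b -> a <> c -> b = c.
Proof.
move=> lat sl xa xb xc nab nac; apply: NNPP => nbc; apply: sl.
have [_ [po _]] := lat.
have [p [ip pa px]] := join_irr_below_cover lat xa.
have [q [iq qb qx]] := join_irr_below_cover lat xb.
have [r [ir rc rx]] := join_irr_below_cover lat xc.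
have nle u v y z : coversb le x u -> coversb le x v -> u <> v -> le y u -> le z v ->
    ~~ le y x -> ~~ le y z.
  move=> xu xv nuv yu zv; apply: contraNN => yz.
  have [_ [_ h]] := coversb_meet lat xu xv nuv.
  by apply: h => //; apply: (po_trans po) zv.
exists p, q, r; do 3!split=> //; split; last split; split.
- exact: (nle a b).
- by apply: (nle b a) => // e; apply: nab.
- exact: (nle a c).
- by apply: (nle c a) => // e; apply: nac.
- exact: (nle b c).
- by apply: (nle c b) => // e; apply: nbc.
Qed.

(* [lc x] and [rc x] are the leftmost and the rightmost upper cover of [x]. *)
Record two_covers n (le : rel 'I_n) (bot top : 'I_n) (lc rc : 'I_n -> 'I_n) : Prop := {
  tc_lat : is_lattice le;
  tc_bot : forall x, le bot x;
  tc_top : forall x, le x top;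
  tc_lc_top : lc top = top;
  tc_rc_top : rc top = top;
  tc_lc : forall x, x <> top -> coversb le x (lc x);
  tc_rc : forall x, x <> top -> coversb le x (rc x);
  tc_covers : forall x y, coversb le x y -> y = lc x \/ y = rc x;
  tc_cell : forall x, lc x <> rc x -> rc (lc x) = lc (rc x) }.

Lemma cross_swap a b c : cross a b c = (- cross a c b)%R.
Proof. by rewrite /cross; ring. Qed.

Section Diagram.
Variables (n : nat) (E : ssdiagram n).
Local Notation le := (dle E).
Local Notation pos := (dpos E).

Let lat : is_lattice le := d_lattice E.
Let po : is_porder le. Proof. by case: lat => _ []. Qed.
Let pl : planar_diagram le pos := d_planar E.

Definition leftb (a b c : 'I_n) : bool :=
  [&& coversb le a b, coversb le a c &
      if Rlt_dec (cross (pos a) (pos b) (pos c)) 0%R then true else false].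

Lemma leftP a b c : reflect (up_left E a b c) (leftb a b c).
Proof.
apply: (iffP and3P) => [[/coversP h1 /coversP h2]|[/coversP h1 [/coversP h2 h3]]].
  by case: Rlt_dec.
by split=> //; case: Rlt_dec.
Qed.

Lemma leftb_total a b c : coversb le a b -> coversb le a c -> b <> c ->
  leftb a b c \/ leftb a c b.
Proof.
move=> ab ac nbc; rewrite /leftb ab ac /=.
have := cross_upper_neq0 pl ab ac nbc.
have := cross_swap (pos a) (pos c) (pos b).
case: (Rlt_dec (cross (pos a) (pos b) (pos c)) 0); first by left.
case: (Rlt_dec (cross (pos a) (pos c) (pos b)) 0); first by right.
by move=> *; exfalso; lra.
Qed.

Lemma leftb_asym a b c : leftb a b c -> ~~ leftb a c b.
Proof.
move=> /leftP [_ [_ h]]; apply/negP => /leftP [_ [_ h']].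
by rewrite cross_swap in h'; lra.
Qed.

Lemma leftb_irr a b : ~~ leftb a b b.
Proof. by apply/negP => h; have := leftb_asym h; rewrite h. Qed.

(** The default [a] is taken at the top, which thus becomes a fixed point, as [two_covers]
    demands. *)
Definition lcov (a : 'I_n) : 'I_n :=
  odflt a [pick b | coversb le a b && [forall c, (coversb le a c && (c != b)) ==> leftb a b c]].

Definition rcov (a : 'I_n) : 'I_n :=
  odflt a [pick c | coversb le a c && [forall b, (coversb le a b && (b != c)) ==> leftb a b c]].

Lemma lrcov a : (exists b, coversb le a b) ->
  [/\ coversb le a (lcov a), coversb le a (rcov a),
      forall b, coversb le a b -> b = lcov a \/ b = rcov a &
      lcov a <> rcov a -> leftb a (lcov a) (rcov a)].
Proof.
move=> [b0 ab0].
have [b [c [ab ac hbc cl]]] : exists b c, [/\ coversb le a b, coversb le a c,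
    forall d, coversb le a d -> d = b \/ d = c & b <> c -> leftb a b c].
  case: (boolP [exists c, coversb le a c && (c != b0)]) => [/existsP [c]|].
    move=> /andP [ac /eqP ncb].
    have two d : coversb le a d -> d = b0 \/ d = c.
      move=> ad; case: (eqVneq b0 d) => [->|/eqP nbd]; first by left.
      right; apply: (slim_upper_covers lat (@d_slim _ E) ab0 ad ac); first by [].
      by move=> e; apply: ncb.
    case: (leftb_total ab0 ac) => [e|l|l]; first by apply: ncb.
      by exists b0, c.
    by exists c, b0; split=> // d /two []; auto.
  move=> /existsPn h; exists b0, b0; split=> // d ad; left.
  by apply/eqP; move: (h d); rewrite ad negbK.
have el : lcov a = b.
  rewrite /lcov; case: pickP => [d /andP [ad /forallP hd]|/(_ b)] /=.
    case: (hbc d ad) => // e; apply/eqP; apply: contraT => nbd.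
    have := hd b; rewrite ab eq_sym nbd /= => ldb.
    have := leftb_asym ldb; rewrite e cl //.
    by move=> e'; rewrite e' e eqxx in nbd.
  rewrite ab /= => /negbT /forallPn [d]; rewrite negb_imply.
  move=> /andP [/andP [ad ndb]]; case: (hbc d ad) => e; subst d.
    by rewrite eqxx in ndb.
  by rewrite cl // => e; rewrite e eqxx in ndb.
have er : rcov a = c.
  rewrite /rcov; case: pickP => [d /andP [ad /forallP hd]|/(_ c)] /=.
    case: (hbc d ad) => // e; apply/eqP; apply: contraT => nbd.
    have := hd c; rewrite ac eq_sym nbd /= => ldb.
    have := leftb_asym ldb; rewrite e cl //.
    by move=> e'; rewrite -e' e eqxx in nbd.
  rewrite ac /= => /negbT /forallPn [d]; rewrite negb_imply.
  move=> /andP [/andP [ad ndb]]; case: (hbc d ad) => e; subst d; last first.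
    by rewrite eqxx in ndb.
  by rewrite cl // => e; rewrite e eqxx in ndb.
by rewrite el er.
Qed.

Lemma leftE a b c : leftb a b c <->
  [/\ b = lcov a, c = rcov a, coversb le a b, coversb le a c & b <> c].
Proof.
split=> [l|[-> -> ab ac nbc]].
  have /and3P [ab ac _] := l.
  have nbc : b <> c by move=> e; move: l; rewrite e; apply/negP; apply: leftb_irr.
  have [|_ _ hbc cl] := @lrcov a; first by exists b.
  case: (hbc b ab) (hbc c ac) => [eb|eb] [ec|ec] //.
  - by case: nbc; rewrite eb ec.
  - have := leftb_asym l; rewrite {1}eb {1}ec cl //.
    by move=> e; apply: nbc; rewrite eb ec.
  - by case: nbc; rewrite eb ec.
have [|_ _ _] := @lrcov a; first by exists (lcov a).
exact.
Qed.

Lemma diagram_two_covers : exists bot top, two_covers le bot top lcov rcov.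
Proof.
have [o ho] := lattice_bot lat; have [u hu] := lattice_top lat.
exists o, u.
have cov a : a <> u -> exists b, coversb le a b.
  by move=> nau; have [b] := upper_cover_below po (hu a) nau; exists b.
have nou b : ~~ coversb le u b.
  apply/negP => ub; apply: (coversb_neq ub); exact: (po_anti po (coversb_le ub) (hu _)).
have [_ [_ [jn _]]] := lat.
split=> //.
- by rewrite /lcov; case: pickP => // b /andP [h]; move: (nou b); rewrite h.
- by rewrite /rcov; case: pickP => // b /andP [h]; move: (nou b); rewrite h.
- by move=> x /cov/lrcov [].
- by move=> x /cov/lrcov [].
- by move=> x y xy; have [|_ _ h _] := @lrcov x; [exists y | apply: h].
move=> x nlr; have nxu : x <> u.
  move=> e; apply: nlr; rewrite e /lcov /rcov; do 2!case: pickP => //=.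
  - by move=> b /andP [h]; move: (nou b); rewrite h.
  - by move=> _ b /andP [h]; move: (nou b); rewrite h.
  - by move=> b /andP [h]; move: (nou b); rewrite h.
have [xb xc _ cl] := lrcov (cov x nxu).
have /leftP [_ [_ cr]] := cl nlr.
move: xb xc nlr cr; set b := lcov x; set c := rcov x => xb xc nbc cr.
have [d jd] := jn b c.
have md := coversb_meet lat xb xc nbc.
(* By semimodularity the join [d] covers both [b] and [c], which closes the cell over [x]. *)
have bd : coversb le b d.
  apply/coversP; apply: (@d_semimod _ E c b x d); last exact/coversP.
    by case: md => [h1 [h2 h3]]; split=> //; split=> // w h4 h5; apply: h3.
  by case: jd => [h1 [h2 h3]]; split=> //; split=> // w h4 h5; apply: h3.
have cd : coversb le c d.
  by apply/coversP; apply: (@d_semimod _ E b c x d) => //; apply/coversP.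
have ncw y w : coversb le y d -> coversb le y w -> w <> d -> ~~ le w d.
  by move=> yd yw; apply: contra_notN => wd; apply: (coversb_le_eq yw yd).
(* Otherwise the edge from [b] to [rcov b] would lie to the right of the edge to [d], that is, enter
   the cell. *)
have -> : rcov b = d.
  apply: NNPP => nd; have [|_ brb hb lb] := @lrcov b; first by exists d.
  case: (hb d bd) => e; last by rewrite e in nd.
  have /leftP [_ [_ cr']] : leftb b d (rcov b).
    by rewrite e; apply: lb => e'; apply: nd; rewrite e -e'.
  apply: (cell_empty_above_left pl po xb xc bd cd brb nbc _ _ _ cr cr') => //.
  exact: (ncw b).
apply/esym; apply: NNPP => nd; have [|clc _ hc lc] := @lrcov c; first by exists d.
case: (hc d cd) => e; first by rewrite e in nd.
have /leftP [_ [_ cr']] : leftb c (lcov c) d.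
  by rewrite e; apply: lc => e'; apply: nd; rewrite e -e'.
apply: (cell_empty_above_right pl po xb xc bd cd clc nbc _ _ _ cr cr') => //.
by apply: (ncw c) => // e'; apply: nd.
Qed.

(** The order of lower covers is determined by the lattice order and the order of upper covers, so
    codes need to record only the latter. Both directions follow by applying [lens_orientation] to
    the lens between the meet [a] and [d]. *)
Lemma low_leftE d y z : low_left E d y z <->
  covers le y d /\ covers le z d /\
  exists a b c, is_meet le y z a /\ up_left E a b c /\ le b y /\ le c z.
Proof.
split=> [[/coversP yd [/coversP zd cr]]|].
  split; first exact/coversP; split; first exact/coversP.
  have nyz : y <> z by move=> e; rewrite e /cross in cr; lra.
  have [_ [_ [_ mt]]] := lat; have [a ma] := mt y z.
  have [ay [az ha]] := ma.
  have nay : a <> y.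
    by move=> e; apply: nyz; apply: (lower_coversb_le_eq yd zd); rewrite -e.
  have naz : a <> z.
    by move=> e; apply: nyz; apply/esym; apply: (lower_coversb_le_eq zd yd); rewrite -e.
  have [b ab bY] := upper_cover_below po ay nay.
  have [c ac cz] := upper_cover_below po az naz.
  exists a, b, c; split=> //; split=> //.
  have nbc : b <> c.
    move=> e; apply: (coversb_neq ab); apply: (po_anti po (coversb_le ab)).
    by apply: ha => //; rewrite e.
  case: (leftb_total ab ac nbc) => /leftP // [_ [_ cr']].
  case: (lens_orientation pl po ac ab zd yd cz bY _ _ cr').
  - by move=> e; apply: nyz.
  - by move=> v h1 h2; apply: ha.
  - by rewrite cross_swap; lra.
case=> /coversP yd [/coversP zd [a [b [c [[ay [az ha]] [ul [bY cz]]]]]]].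
have [/coversP ab [/coversP ac cr]] := ul.
split; first exact/coversP; split; first exact/coversP.
have nyz : y <> z.
  move=> e; apply: (coversb_neq ab); apply: (po_anti po (coversb_le ab)).
  by apply: ha; rewrite -?e.
have := cross_lower_neq0 pl yd zd nyz.
have := lens_orientation pl po ab ac yd zd bY cz nyz ha cr; lra.
Qed.

End Diagram.

(** * The code of a diagram *)

Section Strips.
Variables (n : nat) (le : rel 'I_n) (bot top : 'I_n) (lc rc : 'I_n -> 'I_n).

(* [spt i 0] runs through the left boundary chain; [spt i] is the right boundary chain of
   the filter above [spt i 0]. *)
Definition spt i j := iter j rc (iter i lc bot).

(** The search up to [n] always succeeds, since [n] cover steps lead to the top, where [lc] and [rc]
    agree. *)
Definition turn i := find (fun j => lc (spt i j) == rc (spt i j)) (iota 0 n.+1).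

Definition lat_length := find (fun i => iter i lc bot == top) (iota 0 n.+1).

(** Row [i] has [turn i + 1] elements, at most [lat_length - i]; after reversal the part with index
    [t], counted from 0, is at most [t + 1]. The row of the top is left out. *)
Definition strip_code := rev (mkseq (fun i => (turn i).+1) lat_length).

Hypothesis H : two_covers le bot top lc rc.

Let po : is_porder le. Proof. by case: (tc_lat H) => _ []. Qed.
Local Notation h := lat_length.

Lemma le_lc x : le x (lc x).
Proof.
case: (eqVneq x top) => [->|/eqP nx]; first by rewrite (tc_lc_top H) po_refl.
exact/coversb_le/(tc_lc H).
Qed.

Lemma le_rc x : le x (rc x).
Proof.
case: (eqVneq x top) => [->|/eqP nx]; first by rewrite (tc_rc_top H) po_refl.
exact/coversb_le/(tc_rc H).
Qed.

Lemma top_le x : le top x -> x = top.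
Proof. by move=> tx; apply: (po_anti po) tx; apply: (tc_top H). Qed.

Definition height x := #|[set z | le z x]|.

Lemma height_le x : height x <= n.
Proof. by rewrite -[X in _ <= X]card_ord max_card. Qed.

Lemma height_lt x y : le x y -> x <> y -> height x < height y.
Proof.
move=> xy nxy; apply: proper_card; apply/properP; split.
  by apply/subsetP=> z; rewrite !inE => zx; apply: (po_trans po) zx xy.
exists y; rewrite inE ?po_refl //; apply/negP => yx.
by apply: nxy; apply: (po_anti po).
Qed.

Lemma iter_top f x : (forall y, y <> top -> coversb le y (f y)) -> f top = top ->
  iter n f x = top.
Proof.
move=> hf ft; have fix_top k : iter k f top = top by elim: k => //= k ->.
apply: NNPP => nt.
suff hk k : k <= n -> k < height (iter k f x).
  by have := hk n (leqnn n); rewrite ltnNge height_le.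
elim: k => [|k IH] kn.
  by apply/card_gt0P; exists x; rewrite inE po_refl.
have nk : iter k f x <> top.
  move=> e; apply: nt.
    have <- : iter (n - k) f (iter k f x) = iter n f x by rewrite -iterD subnK // ltnW.
    by rewrite e fix_top.
apply: leq_ltn_trans (IH (ltnW kn)) _.
by apply: height_lt; [apply: coversb_le; apply: hf | apply/coversb_neq/hf].
Qed.

Lemma iter_lc_length : iter h lc bot = top.
Proof.
have hs : has (fun i => iter i lc bot == top) (iota 0 n.+1).
  apply/hasP; exists n; first by rewrite mem_iota leq0n add0n leqnn.
  by apply/eqP; apply: iter_top; [apply: (tc_lc H) | apply: (tc_lc_top H)].
have := nth_find 0 hs; rewrite -/h.
by move: hs; rewrite has_find size_iota => hs; rewrite nth_iota // => /eqP.
Qed.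

Lemma iter_lc_top i : h <= i -> iter i lc bot = top.
Proof.
move=> hi; rewrite -(subnK hi) iterD iter_lc_length.
by elim: (i - h) => //= k ->; apply: (tc_lc_top H).
Qed.

Lemma iter_lc_ntop i : i < h -> iter i lc bot <> top.
Proof.
move=> ih; have := before_find 0 ih; rewrite nth_iota; first by move=> /eqP.
by apply: leq_trans ih _; have := find_size (fun i => iter i lc bot == top) (iota 0 n.+1);
  rewrite size_iota.
Qed.

Lemma turn_eq i : lc (spt i (turn i)) = rc (spt i (turn i)).
Proof.
have hs : has (fun j => lc (spt i j) == rc (spt i j)) (iota 0 n.+1).
  apply/hasP; exists n; first by rewrite mem_iota leq0n add0n leqnn.
  rewrite /spt iter_top ?(tc_lc_top H) ?(tc_rc_top H) //; exact: (tc_rc H).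
have := nth_find 0 hs; rewrite -/(turn i).
by move: hs; rewrite has_find size_iota => hs; rewrite nth_iota // => /eqP.
Qed.

Lemma turn_neq i j : j < turn i -> lc (spt i j) <> rc (spt i j).
Proof.
move=> ih; have := before_find 0 ih; rewrite nth_iota; first by move=> /eqP.
apply: leq_trans ih _; rewrite /turn; set s := find _ _.
by have := find_size (fun j => lc (spt i j) == rc (spt i j)) (iota 0 n.+1); rewrite size_iota.
Qed.

Lemma turn_le i j : lc (spt i j) = rc (spt i j) -> turn i <= j.
Proof. by move=> e; rewrite leqNgt; apply/negP => /turn_neq. Qed.

Lemma spt_ntop i j : j < turn i -> spt i j <> top.
Proof.
by move=> /turn_neq ne e; apply: ne; rewrite e (tc_lc_top H) (tc_rc_top H).
Qed.

(** Before the turn every step of the row spans a cell, so [lc] commutes past each [rc]: left covers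
    of row [i] run through row [i.+1] in the same columns. *)
Lemma spt_lc i j : j <= turn i -> lc (spt i j) = spt i.+1 j.
Proof.
elim: j => [|j IH] // jt.
by rewrite -[spt i j.+1]/(rc (spt i j)) -(tc_cell H (turn_neq jt)) IH // ltnW.
Qed.

(** At the turn [lc] and [rc] agree, so row [i] enters row [i.+1] and from there on is that row
    shifted by one column. *)
Lemma spt_turn i j : turn i <= j -> spt i j.+1 = spt i.+1 j.
Proof.
elim: j => [|j IH].
  rewrite leqn0 => /eqP e; have := turn_eq i; rewrite e => e'.
  by rewrite -[spt i 1]/(rc (spt i 0)) -e'.
rewrite leq_eqVlt => /orP [/eqP e|/IH e]; last by rewrite -[LHS]/(rc (spt i j.+1)) e.
have := turn_eq i; rewrite e -[spt i j.+2]/(rc (spt i j.+1)) => <-.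
by rewrite spt_lc // e.
Qed.

Lemma turn_top i : h <= i -> turn i = 0.
Proof.
move=> hi; apply/eqP; rewrite -leqn0; apply: turn_le.
by rewrite /spt /= iter_lc_top // (tc_lc_top H) (tc_rc_top H).
Qed.

Lemma spt_le_left i i' j : i' <= i -> le (iter i' lc bot) (spt i j).
Proof.
move=> hi; apply: (@po_trans _ _ po _ (iter i lc bot)).
  rewrite -(subnK hi) iterD; elim: (i - i') => [|k IH] /=; first exact: po_refl.
  exact: po_trans IH (le_lc _).
rewrite /spt; elim: j => [|j IH] /=; first exact: po_refl.
exact: po_trans IH (le_rc _).
Qed.

(** If the next left boundary element were below [rc y] with [y] in the row before the turn, it
    would also be below [lc y], which is in row [i.+1], hence below their meet [y]. Descending along
    the row leads back to the left boundary. *)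
Lemma spt_not_above i j : i < h -> j <= turn i -> ~~ le (iter i.+1 lc bot) (spt i j).
Proof.
move=> ih; have ni := iter_lc_ntop ih.
elim: j => [|j IH] jt.
  apply/negP => l; apply: (coversb_neq (tc_lc H ni)).
  by apply: (po_anti po) l; apply: le_lc.
have nt := spt_ntop jt; apply: contraNN (IH (ltnW jt)) => l.
have [_ [_ hm]] := coversb_meet (tc_lat H) (tc_lc H nt) (tc_rc H nt) (turn_neq jt).
apply: hm => //; rewrite spt_lc; last exact: ltnW.
exact: spt_le_left.
Qed.

Lemma spt_row i j i' : i <= h -> j <= turn i -> i' <= h ->
  le (iter i' lc bot) (spt i j) = (i' <= i).
Proof.
move=> ih jt ih'; case: leqP => [|ii']; first exact: spt_le_left.
apply/negbTE; apply: contraNN (spt_not_above (leq_trans ii' ih') jt).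
by apply: (po_trans po); apply: (@spt_le_left _ _ 0).
Qed.

Lemma spt_inj i j i' j' : i <= h -> j <= turn i -> i' <= h -> j' <= turn i' ->
  spt i j = spt i' j' -> i = i' /\ j = j'.
Proof.
move=> ih jt ih' jt' e.
have ei : i = i'.
  apply/eqP; rewrite eqn_leq -(spt_row ih' jt' ih) -e spt_row // leqnn /=.
  by rewrite -(spt_row ih jt ih') e spt_row.
split=> //; subst i'.
have mono k k' : k < k' -> k' <= turn i -> height (spt i k) < height (spt i k').
  move=> kk' kt; elim: k' kk' kt => // k' IH; rewrite ltnS leq_eqVlt => hk kt.
  have nt := spt_ntop kt.
  have lt : height (spt i k') < height (spt i k'.+1).
    by apply: height_lt; [apply: le_rc | apply/coversb_neq/(tc_rc H)].
  by case/orP: hk => [/eqP -> // | hk]; apply: leq_trans (IH hk (ltnW kt)) (ltnW lt).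
case: (ltngtP j j') => // hj.
  by have := mono _ _ hj jt'; rewrite e ltnn.
by have := mono _ _ hj jt; rewrite e ltnn.
Qed.

(** Past the turn, [(i, j)] and [(i.+1, j.-1)] name the same element by [spt_turn]. The reduction
    consults only the turns, so diagrams with equal codes reduce indices alike. *)
Fixpoint spt_nf (t : nat -> nat) i j :=
  if j <= t i then (i, j) else if j is j'.+1 then spt_nf t i.+1 j' else (i, j).

(** Rows from the length on contain only the top, which gets the name [(m, 0)]. *)
Definition spt_nf_cap (t : nat -> nat) m i j :=
  if m <= (spt_nf t i j).1 then (m, 0) else spt_nf t i j.

Lemma spt_nfP i j (p := spt_nf_cap turn h i j) :
  [/\ p.1 <= h, p.2 <= turn p.1 & spt p.1 p.2 = spt i j].
Proof.
have [h1 h2] : let q := spt_nf turn i j in q.2 <= turn q.1 /\ spt q.1 q.2 = spt i j.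
  elim: j i {p} => [|j IH] i //=; case: ifP => //= ji.
  have [? ->] := IH i.+1; split=> //.
  by apply/esym; apply: spt_turn; rewrite -ltnS ltnNge ji.
rewrite /p /spt_nf_cap; case: (leqP h (spt_nf turn i j).1) => [hq|hq];
  last by split; [apply: ltnW | exact: h1 | exact: h2].
split=> //; rewrite -h2; move: h2 h1; case: (spt_nf turn i j) hq => a b /= hq _.
by rewrite turn_top // leqn0 => /eqP ->; rewrite /spt /= iter_lc_length iter_lc_top.
Qed.

(** By induction on [height]: an element other than the bottom is [lc c] or [rc c] for a lower cover
    [c], and the normal form of [c] stops at or before the turn, where [spt_lc] applies. *)
Lemma spt_surj x : exists i j, [/\ i <= h, j <= turn i & spt i j = x].
Proof.
suff [i [j <-]] : exists i j, spt i j = x.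
  by have [h1 h2 h3] := spt_nfP i j; exists (spt_nf_cap turn h i j).1, (spt_nf_cap turn h i j).2.
move: {2}(height x).+1 (ltnSn (height x)) => k; elim: k x => // k IH x hk.
case: (eqVneq bot x) => [<-|/eqP nb]; first by exists 0, 0.
have [c cx bc] := lower_cover_above po (tc_bot H x) nb.
have hc : height c < k.
  apply: (@leq_trans (height x)); last by rewrite -ltnS.
  exact: height_lt (coversb_le cx) (coversb_neq cx).
have [i0 [j0 e0]] := IH c hc.
have := spt_nfP i0 j0; rewrite e0; case: (spt_nf_cap _ _ _ _) => a b /= [_ hb e].
case: (tc_covers H cx) => ->; rewrite -e.
  by exists a.+1, b; rewrite spt_lc.
by exists a, b.+1.
Qed.

Lemma spt_top i j : h <= i + j -> spt i j = top.
Proof.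
elim: j i => [|j IH] i hij; first by rewrite /spt /= iter_lc_top // -[i]addn0.
have e : spt i.+1 j = top by apply: IH; rewrite addSnnS.
have [jt|jt] := leqP (turn i) j; first by rewrite spt_turn.
exfalso; have nt := spt_ntop jt; apply: (turn_neq jt).
have e1 := spt_lc (ltnW jt); rewrite e in e1.
apply/esym; apply: (coversb_le_eq (tc_rc H nt) (tc_lc H nt)).
by rewrite e1; apply: (tc_top H).
Qed.

(** Column [h - i] of row [i] is the top, while no element up to the turn is above the next left
    boundary element. *)
Lemma turn_lt i : i < h -> turn i < h - i.
Proof.
move=> ih; rewrite ltnNge; apply/negP => ht.
have /negP := spt_not_above ih ht; apply.
have -> : spt i (h - i) = top by apply: spt_top; rewrite subnKC // ltnW.
exact: (tc_top H).
Qed.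

Lemma card_row i : i < h ->
  #|[set x | le (iter i lc bot) x && ~~ le (iter i.+1 lc bot) x]| = (turn i).+1.
Proof.
move=> ih; rewrite -[RHS]card_ord -(@card_imset _ _ (fun j : 'I_(turn i).+1 => spt i j)).
  apply: eq_card => x; rewrite inE; apply/andP/imsetP => [[l1 l2]|[j _ ->]].
    have [a [b [ha hb e]]] := spt_surj x; subst x.
    rewrite spt_row // in l1; last exact: ltnW.
    rewrite spt_row // -ltnNge ltnS in l2.
    have ea : a = i by apply/eqP; rewrite eqn_leq l2.
    by subst a; exists (Ordinal (hb : b < (turn i).+1)).
  have jt : j <= turn i by rewrite -ltnS.
  by split; [apply: spt_le_left | apply: spt_not_above].
move=> j j' /spt_inj [] //; try exact: ltnW.
- by rewrite -ltnS.
- by rewrite -ltnS.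
- by move=> _ /val_inj.
Qed.

(** Rows [0] to [h] list every element once; the last of them is the top alone, hence [n.-1]. *)
Lemma strip_code_sum : sumn strip_code = n.-1.
Proof.
pose L := [seq spt i j | i <- iota 0 h.+1, j <- iota 0 (turn i).+1].
have uL : uniq L.
  apply: allpairs_uniq_dep; first exact: iota_uniq.
    by move=> i _; apply: iota_uniq.
  move=> p p' /allpairsPdep [a [b [ha hb ->]]] /allpairsPdep [a' [b' [ha' hb' ->]]] /=.
  move: ha hb ha' hb'; rewrite !mem_iota !add0n !ltnS /= => ha hb ha' hb'.
  by case/spt_inj => // -> ->.
have sL : size L = n.
  rewrite -(card_uniqP uL) -[RHS]card_ord; apply: eq_card => x; apply/idP.
  have [i [j [ih jt <-]]] := spt_surj x.
  by apply/allpairsPdep; exists i, j; rewrite !mem_iota !add0n !ltnS.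
have : sumn (mkseq (fun i => (turn i).+1) h.+1) = n.
  rewrite -sL size_allpairs_dep /mkseq; congr sumn.
  by apply: eq_map => i; rewrite size_iota.
rewrite /strip_code sumn_rev mkseqS sumn_rcons turn_top // addn1 => <-.
by [].
Qed.

Definition code_valid (c : seq nat) :=
  forall t, t < size c -> 0 < nth 0 c t <= t.+1.

Lemma strip_code_valid : code_valid strip_code.
Proof.
move=> t; rewrite size_rev size_mkseq => th.
rewrite nth_rev size_mkseq // nth_mkseq; last by rewrite subnSK // leq_subr.
have hi : h - t.+1 < h by rewrite subnSK // leq_subr.
by have := turn_lt hi; rewrite subKn.
Qed.

Lemma le_connect x y : le x y = connect (fun a b => (b == lc a) || (b == rc a)) x y.
Proof.
apply/idP/connectP => [xy|[p pp ->]].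
  have [p [pp <- _]] := cover_path po xy; exists p => //.
  apply: sub_path pp => a b /(tc_covers H) [] ->; by rewrite eqxx ?orbT.
elim: p x pp => [|z p IH] x /=; first by rewrite po_refl.
by move=> /andP [/orP [] /eqP -> /IH]; apply: (po_trans po); [apply: le_lc|apply: le_rc].
Qed.

End Strips.

Lemma strip_code_eq n (bot top bot' top' : 'I_n) lc rc lc' rc' :
  strip_code bot top lc rc = strip_code bot' top' lc' rc' ->
  lat_length bot top lc = lat_length bot' top' lc' /\
  forall i, i < lat_length bot top lc -> turn bot lc rc i = turn bot' lc' rc' i.
Proof.
move=> /(congr1 rev); rewrite !revK => e.
have es : lat_length bot top lc = lat_length bot' top' lc'.
  by have := congr1 size e; rewrite !size_mkseq.
split=> // i ih; have := congr1 (nth 0 ^~ i) e.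
by rewrite !nth_mkseq -?es // => -[].
Qed.

(** * Equality of codes and similarity *)

Section Iso.
Variables (n : nat) (le le' : rel 'I_n) (bot top bot' top' : 'I_n).
Variables (lc rc lc' rc' : 'I_n -> 'I_n).
Hypothesis H : two_covers le bot top lc rc.
Hypothesis H' : two_covers le' bot' top' lc' rc'.

(** Normal forms are unique in the first diagram, so both index pairs have the same one; equal codes
    give the same reductions in the second diagram. *)
Lemma spt_transfer i j i2 j2 :
  strip_code bot top lc rc = strip_code bot' top' lc' rc' ->
  spt bot lc rc i j = spt bot lc rc i2 j2 ->
  spt bot' lc' rc' i j = spt bot' lc' rc' i2 j2.
Proof.
move=> /strip_code_eq [eh et].
have et' : turn bot lc rc =1 turn bot' lc' rc'.
  move=> k; have [hk|/et //] := leqP (lat_length bot top lc) k.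
  by rewrite (turn_top H) // (turn_top H') // -eh.
have enf k l : spt_nf_cap (turn bot lc rc) (lat_length bot top lc) k l =
    spt_nf_cap (turn bot' lc' rc') (lat_length bot' top' lc') k l.
  rewrite /spt_nf_cap -eh.
  suff -> : spt_nf (turn bot lc rc) k l = spt_nf (turn bot' lc' rc') k l by [].
  by elim: l k => [|l IH] k /=; rewrite ?et' ?IH.
move=> e; have [a1 a2 a3] := spt_nfP H i j; have [b1 b2 b3] := spt_nfP H i2 j2.
have [_ _ <-] := spt_nfP H' i j; have [_ _ <-] := spt_nfP H' i2 j2.
rewrite -!enf.
by have [|-> ->] := spt_inj H a1 a2 b1 b2; first by rewrite a3 b3.
Qed.

Lemma le_hom phi : (forall x, phi (lc x) = lc' (phi x)) ->
  (forall x, phi (rc x) = rc' (phi x)) ->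
  forall x y, le x y -> le' (phi x) (phi y).
Proof.
move=> hl hr x y; rewrite (le_connect H) (le_connect H') => /connectP [p pp ->] {y}.
apply/connectP; exists (map phi p); last by rewrite last_map.
rewrite path_map; apply: sub_path pp => a b /orP [] /eqP -> /=.
  by rewrite hl eqxx.
by rewrite hr eqxx orbT.
Qed.

End Iso.

Lemma strip_iso n (le le' : rel 'I_n) (bot top bot' top' : 'I_n) lc rc lc' rc' :
  two_covers le bot top lc rc -> two_covers le' bot' top' lc' rc' ->
  strip_code bot top lc rc = strip_code bot' top' lc' rc' ->
  exists phi psi : 'I_n -> 'I_n, [/\ cancel phi psi, cancel psi phi,
    forall x, phi (lc x) = lc' (phi x) & forall x, phi (rc x) = rc' (phi x)].
Proof.
move=> H H' ec.
have ex (le1 le2 : rel 'I_n) bot1 top1 bot2 top2 lc1 rc1 lc2 rc2 :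
    two_covers le1 bot1 top1 lc1 rc1 -> two_covers le2 bot2 top2 lc2 rc2 ->
    strip_code bot1 top1 lc1 rc1 = strip_code bot2 top2 lc2 rc2 ->
    exists phi, forall i j, phi (spt bot1 lc1 rc1 i j) = spt bot2 lc2 rc2 i j :> 'I_n.
  move=> H1 H2 e12.
  (* Each [spt i j] is sent to the element with the same indices; [spt_transfer] makes this
     independent of the indices chosen. *)
  have /fin_all_exists [phi hphi] : forall x : 'I_n, exists y : 'I_n,
      exists i j, spt bot1 lc1 rc1 i j = x /\ y = spt bot2 lc2 rc2 i j.
    move=> x; have [i [j [_ _ e]]] := spt_surj H1 x.
    by exists (spt bot2 lc2 rc2 i j), i, j.
  exists phi => i j; have [i2 [j2 [e ->]]] := hphi (spt bot1 lc1 rc1 i j).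
  exact: (spt_transfer H1 H2 e12 e).
have [phi hphi] := ex _ _ _ _ _ _ _ _ _ _ H H' ec.
have [psi hpsi] := ex _ _ _ _ _ _ _ _ _ _ H' H (esym ec).
have [_ et] := strip_code_eq ec.
have et' : turn bot lc rc =1 turn bot' lc' rc'.
  move=> k; have [hk|/et //] := leqP (lat_length bot top lc) k.
  by rewrite (turn_top H) // (turn_top H') // -(strip_code_eq ec).1.
exists phi, psi; split=> x.
- by have [i [j [_ _ <-]]] := spt_surj H x; rewrite hphi hpsi.
- by have [i [j [_ _ <-]]] := spt_surj H' x; rewrite hpsi hphi.
- have [i [j [_ jt <-]]] := spt_surj H x.
  by rewrite (spt_lc H jt) !hphi (spt_lc H') // -et'.
have [i [j [_ jt <-]]] := spt_surj H x.
by rewrite -[rc _]/(spt bot lc rc i j.+1) !hphi.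
Qed.

Section OrderIso.
Variables (n : nat) (le le' : rel 'I_n) (phi psi : 'I_n -> 'I_n).
Hypothesis phiK : cancel phi psi.
Hypothesis psiK : cancel psi phi.
Hypothesis le_iso : forall x y, le x y = le' (phi x) (phi y).

Lemma covers_iso x y : covers le x y <-> covers le' (phi x) (phi y).
Proof.
have lt_iso u v : lt_ le u v <-> lt_ le' (phi u) (phi v).
  rewrite /lt_ le_iso; split=> -[h1 h2]; split=> //.
    by move=> /(can_inj phiK).
  by move=> e; apply: h2; rewrite e.
split=> -[h1 h2]; (split; first exact/lt_iso) => -[z [z1 z2]]; apply: h2.
  by exists (psi z); rewrite !lt_iso psiK.
by exists (phi z); rewrite -!lt_iso.
Qed.

Lemma meet_iso x y m : is_meet le x y m <-> is_meet le' (phi x) (phi y) (phi m).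
Proof.
rewrite /is_meet !le_iso; split=> -[h1 [h2 h3]]; split=> //; split=> // u.
  by rewrite -(psiK u) -!le_iso; apply: h3.
by rewrite !le_iso; apply: h3.
Qed.

End OrderIso.

Lemma coversb_iso n (le le' : rel 'I_n) phi psi : cancel phi psi -> cancel psi phi ->
  (forall x y, le x y = le' (phi x) (phi y)) ->
  forall x y, coversb le x y = coversb le' (phi x) (phi y).
Proof.
move=> phiK psiK iso x y; have h := covers_iso phiK psiK iso x y.
by apply/coversP/coversP; apply h.
Qed.

Definition has_code n (E : ssdiagram n) (c : seq nat) : Prop :=
  exists bot top, two_covers (dle E) bot top (lcov E) (rcov E) /\
    c = strip_code bot top (lcov E) (rcov E).

Lemma has_code_exists n (E : ssdiagram n) :
  exists c, [/\ has_code E c, code_valid c & sumn c = n.-1].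
Proof.
have [bot [top H]] := diagram_two_covers E.
exists (strip_code bot top (lcov E) (rcov E)); split.
- by exists bot, top.
- exact: strip_code_valid H.
- exact: strip_code_sum H.
Qed.

Lemma has_code_similar n (E E' : ssdiagram n) c : has_code E c -> has_code E' c ->
  similar E E'.
Proof.
move=> [bot [top [H ->]]] [bot' [top' [H' ec]]].
have [phi [psi [phiK psiK hl hr]]] := strip_iso H H' ec.
have le_iso x y : dle E x y = dle E' (phi x) (phi y).
  apply/idP/idP; first exact: (le_hom H H' hl hr).
  rewrite -{2}(phiK x) -{2}(phiK y); apply: (le_hom H' H) => z.
    by rewrite -{1}(psiK z) -hl phiK.
  by rewrite -{1}(psiK z) -hr phiK.
have up a b c0 : up_left E a b c0 <-> up_left E' (phi a) (phi b) (phi c0).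
  have := leftE E a b c0; have := leftE E' (phi a) (phi b) (phi c0).
  move=> h1 h2; have cov := coversb_iso phiK psiK le_iso.
  split=> /leftP l; apply/leftP.
    by apply/h1; move/h2: l => [-> -> l1 l2 l3]; split;
      rewrite -?hl -?hr -?cov // => /(can_inj phiK).
  apply/h2; move/h1: l => [l1 l2 l3 l4 l5]; split; rewrite ?cov //.
  - by apply: (can_inj phiK); rewrite hl.
  - by apply: (can_inj phiK); rewrite hr.
  - by move=> e; apply: l5; rewrite e.
exists phi; split; first by exists psi.
split=> //; split=> // a b c0.
rewrite !low_leftE -!(covers_iso phiK psiK le_iso).
split=> -[h1 [h2 [m [p [q [h3 [h4 [h5 h6]]]]]]]]; split=> //; split=> //.
  exists (phi m), (phi p), (phi q).
  by rewrite -(meet_iso psiK le_iso) -up -!le_iso.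
exists (psi m), (psi p), (psi q).
by rewrite (meet_iso psiK le_iso) up !le_iso !psiK.
Qed.

Lemma similar_has_code n (E E' : ssdiagram n) c c' : similar E E' ->
  has_code E c -> has_code E' c' -> c = c'.
Proof.
move=> [phi [[psi phiK psiK] [le_iso [up _]]]] [bot [top [H ->]]] [bot' [top' [H' ->]]].
have po' : is_porder (dle E') by case: (tc_lat H') => _ [].
have ebot : phi bot = bot'.
  apply: (po_anti po'); last exact: (tc_bot H').
  by rewrite -(psiK bot') -le_iso; apply: (tc_bot H).
have etop : phi top = top'.
  apply: (po_anti po'); first exact: (tc_top H').
  by rewrite -(psiK top') -le_iso; apply: (tc_top H).
have cov := coversb_iso phiK psiK le_iso.
have lr a : phi (lcov E a) = lcov E' (phi a) /\ phi (rcov E a) = rcov E' (phi a).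
  case: (eqVneq a top) => [->|/eqP nat].
    by rewrite (tc_lc_top H) (tc_rc_top H) etop (tc_lc_top H') (tc_rc_top H').
  have nat' : phi a <> top' by rewrite -etop => /(can_inj phiK).
  have la := tc_lc H nat; have ra := tc_rc H nat.
  case: (eqVneq (lcov E a) (rcov E a)) => [e|/eqP ne]; last first.
    have /leftP/up/leftP/leftE [//] : leftb E a (lcov E a) (rcov E a).
    by apply/leftE.
  (* [up_left] says nothing at an element with a single upper cover. Its image must have a single
     one too, as two would be ordered and could be pulled back. *)
  suff e' : lcov E' (phi a) = rcov E' (phi a).
    by rewrite -e e'; rewrite cov in la; case: (tc_covers H' la); rewrite ?e'.
  apply: NNPP => ne'.
  have /leftP : leftb E' (phi a) (lcov E' (phi a)) (rcov E' (phi a)).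
    by apply/leftE; split=> //; [apply: (tc_lc H') | apply: (tc_rc H')].
  rewrite -(psiK (lcov E' (phi a))) -(psiK (rcov E' (phi a))) => /up/leftP/leftE.
  by move=> [e1 e2 _ _]; apply; rewrite e1 e2.
have hspt i j : phi (spt bot (lcov E) (rcov E) i j) = spt bot' (lcov E') (rcov E') i j.
  rewrite /spt; elim: j => [|j IH] /=; last by rewrite (lr _).2 IH.
  by elim: i => [|i IH] //=; rewrite (lr _).1 IH.
have elen : lat_length bot top (lcov E) = lat_length bot' top' (lcov E').
  apply: eq_find => i; rewrite -[iter i _ bot']/(spt bot' (lcov E') (rcov E') i 0) -hspt.
  by rewrite -etop (can_eq phiK).
rewrite /strip_code elen; congr rev; apply: eq_map => i; congr _.+1.
by apply: eq_find => j; rewrite -hspt -(lr _).1 -(lr _).2 (can_eq phiK).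
Qed.

(** * Diagrams with a prescribed code *)

Section Plot.
Variables (n : nat) (r k : 'I_n -> nat).

(** The grid turned by 45 degrees: [k] grows to the upper right, [r] to the upper left. *)
Definition plot (x : 'I_n) : pt := (INR (k x) - INR (r x), INR (k x) + INR (r x))%R.

Lemma on_seg_plot p x y : r x <= r y -> k x <= k y -> on_seg p (plot x) (plot y) ->
  (INR (k x) <= (fst p + snd p) / 2 <= INR (k y))%R /\
  (INR (r x) <= (snd p - fst p) / 2 <= INR (r y))%R.
Proof.
move=> /leP/le_INR hr /leP/le_INR hk [t [ht [-> ->]]] /=.
by split; split; nra.
Qed.

Hypothesis inj : forall x y, r x = r y -> k x = k y -> x = y.

(** An edge stays in the grid rectangle spanned by its ends, so a vertex on it lies between them in
    the order. If edges [a b] and [c d] meet, then [a] is below [d] and [c] below [b]; the join of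
    [a] and [c] lies between the ends of both edges, hence is an end of both. *)
Lemma order_embedding_planar (le : rel 'I_n) : is_lattice le ->
  (forall x y, le x y = (r x <= r y) && (k x <= k y)) ->
  planar_diagram le plot.
Proof.
move=> [_ [po [jn _]]] leE.
have cE x y : covers le x y -> le x y by case=> -[].
split; [|split; [|split]].
- move=> x y [h1 h2].
  by apply: inj; apply: INR_eq; lra.
- move=> x y [[xy nxy] _]; move: xy; rewrite leE => /andP [hr hk] /=.
  have : (k x + r x < k y + r y)%N.
    case: (ltngtP (r x) (r y)) hr => // e1 _; case: (ltngtP (k x) (k y)) hk => // e2 _; try lia.
    by case: nxy; apply: inj.
  by move=> /ltP/lt_INR; rewrite !plus_INR.
- move=> v x y xy nvx nvy.
  have := cE _ _ xy; rewrite leE => /andP [hr hk] /(on_seg_plot hr hk) /= h.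
  have xv : le x v.
    by rewrite leE; apply/andP; split; apply/leP; apply: INR_le; lra.
  have vy : le v y.
    by rewrite leE; apply/andP; split; apply/leP; apply: INR_le; lra.
  by case: xy => _; apply; exists v; split; split=> //; apply: not_eq_sym.
move=> a b c d ab cd nac nad nbc nbd [p [p1 p2]].
have := cE _ _ ab; rewrite leE => /andP [hr hk].
have := cE _ _ cd; rewrite leE => /andP [hr' hk'].
have {p1} q1 := on_seg_plot hr hk p1; have {p2} q2 := on_seg_plot hr' hk' p2.
have ad : le a d.
  by rewrite leE; apply/andP; split; apply/leP; apply: INR_le; lra.
have cb : le c b.
  by rewrite leE; apply/andP; split; apply/leP; apply: INR_le; lra.
have [j [aj [cj hj]]] := jn a c.
have jb : le j b by apply: hj => //; apply: cE.
have jd : le j d by apply: hj => //; apply: cE.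
move/coversP: ab => ab; move/coversP: cd => cd.
case: (coversb_between ab aj jb) => e1; case: (coversb_between cd cj jd) => e2.
- by apply: nac; rewrite -e1.
- by apply: nad; rewrite -e1.
- by apply: nbc; rewrite -e1.
- by apply: nbd; rewrite -e1.
Qed.

End Plot.

(* The lattice of the sets [{t < h | t < i or a t < k}] for an injective sequence [a].
   A set is represented by the pair [(i, k)] with both components maximal; [rk_point] is
   the corresponding condition on pairs. *)
Definition rk_point (h : nat) (a : nat -> nat) i k : Prop :=
  [/\ i <= h, k <= a i & forall t, t < i -> a t <> k].

(** * The lattice of a permutation *)

Section PermModel.
Variables (h : nat) (a : nat -> nat).
Hypothesis a_lt : forall t, t < h -> a t < h.
(** With this value row [h] consists of the single point [(h, h)], the top. *)
Hypothesis a_h : a h = h.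
Hypothesis a_inj : forall t t', t < h -> t' < h -> a t = a t' -> t = t'.

Variables (n : nat) (r k : 'I_n -> nat).
Hypothesis rkP : forall x, rk_point h a (r x) (k x).
Hypothesis rk_ex : forall i j, rk_point h a i j -> exists x, r x = i /\ k x = j.
Hypothesis rk_inj : forall x y, r x = r y -> k x = k y -> x = y.

Definition rk_le (x y : 'I_n) := (r x <= r y) && (k x <= k y).
Local Notation le := rk_le.

Definition feas i j : {set 'I_h} := [set t : 'I_h | (t < i) || (a t < j)].
Local Notation S x := (feas (r x) (k x)).

Lemma r_le x : r x <= h. Proof. by case: (rkP x). Qed.

Lemma k_le x : k x <= h.
Proof.
case: (rkP x); rewrite leq_eqVlt => /orP [/eqP -> | /a_lt]; first by rewrite a_h.
by move=> h1 h2 _; apply: leq_trans h2 (ltnW h1).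
Qed.

Lemma feas_le i j i' j' : i <= i' -> j <= j' -> feas i j \subset feas i' j'.
Proof.
move=> hi hj; apply/subsetP=> t; rewrite !inE => /orP [] ht.
  by rewrite (leq_trans ht hi).
by rewrite (leq_trans ht hj) orbT.
Qed.

Lemma feas_row i x : i <= h -> (feas i 0 \subset S x) = (i <= r x).
Proof.
move=> ih; apply/idP/idP => [/subsetP s|hi]; last exact: feas_le.
rewrite leqNgt; apply/negP => hi.
have := s (Ordinal (leq_trans hi ih)); rewrite !inE /= hi ltnn /= => /(_ isT).
by case: (rkP x) => _ h2 _; rewrite ltnNge h2.
Qed.

(** For the converse: [a] is onto below [h], and if [k y < k x], the [t] with [a t = k y] is in the
    set of [x] but not in that of [y], as the value [k y] does not occur before position [r y]. *)
Lemma rk_leE x y : le x y = (S x \subset S y).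
Proof.
apply/idP/idP => [/andP [hr hk]|s]; first exact: feas_le.
have hr : r x <= r y.
  by rewrite -feas_row ?r_le //; apply: subset_trans s; apply: feas_le.
rewrite /rk_le hr leqNgt; apply/negP => hk.
have kh : k y < h by apply: leq_trans hk (k_le x).
have [t et] : exists t : 'I_h, a t = k y.
  pose f (t : 'I_h) : 'I_h := Ordinal (a_lt (ltn_ord t)).
  have f_inj : injective f.
    by move=> t t' e; apply: val_inj; apply: (a_inj _ _ (congr1 val e)).
  exists (invF f_inj (Ordinal kh)).
  by have := congr1 val (f_invF f_inj (Ordinal kh)).
have : t \in S y.
  by move/subsetP: s; apply; rewrite inE et hk orbT.
by rewrite inE et ltnn orbF => ht; case: (rkP y) => _ _ /(_ _ ht).
Qed.

(** Each component is enlarged as far as the set permits; maximality of both yields [rk_point]. *)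
Lemma feas_point i j : i <= h -> j <= h -> exists x, S x = feas i j.
Proof.
move=> ih jh.
have exi : exists m, (m <= h) && (feas m 0 \subset feas i j).
  by exists i; rewrite ih feas_le.
have exj : exists m, (m <= h) && (feas 0 m \subset feas i j).
  by exists j; rewrite jh feas_le.
have bound (P : pred nat) m : (m <= h) && P m -> m <= h by case/andP.
case: (ex_maxnP exi (bound _)) => i' /andP [ih' si] maxi.
case: (ex_maxnP exj (bound _)) => j' /andP [jh' sj] maxj.
have ii' : i <= i' by apply: maxi; rewrite ih feas_le.
have jj' : j <= j' by apply: maxj; rewrite jh feas_le.
have es : feas i' j' = feas i j.
  apply/eqP; rewrite eqEsubset [X in _ && X]feas_le // andbT; apply/subsetP => t.
  rewrite inE => /orP [] ht.
    by move/subsetP: si; apply; rewrite inE ht.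
  by move/subsetP: sj; apply; rewrite inE ht orbT.
suff /rk_ex [x [e1 e2]] : rk_point h a i' j' by exists x; rewrite e1 e2.
split=> //.
  case: (ltngtP i' h) ih' => // [lt _|-> _]; last by rewrite a_h.
  have : ~~ (feas i'.+1 0 \subset feas i j).
    by apply/negP => s; have := maxi i'.+1; rewrite lt s ltnn => /(_ isT).
  move=> /subsetPn [t]; rewrite -es !inE ltnS orbF negb_or -leqNgt -leqNgt.
  by move=> h1 /andP [h2]; rewrite (_ : i' = t) //; apply/eqP; rewrite eqn_leq h1 h2.
move=> t ht e.
have th : t < h by apply: leq_trans ht ih'.
have lt : j' < h by rewrite -e; apply: a_lt.
have : ~~ (feas 0 j'.+1 \subset feas i j).
  by apply/negP => s; have := maxj j'.+1; rewrite lt s ltnn => /(_ isT).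
move=> /subsetPn [u]; rewrite -es !inE /= ltnS negb_or -leqNgt -leqNgt.
move=> h1 /andP [h2 h3]; have e' : a t = a u by lia.
by have := a_inj th (ltn_ord u) e'; lia.
Qed.

Lemma rk_porder : is_porder le.
Proof.
split; [|split] => [x|x y /andP [h1 h2] /andP [h3 h4]|x y z /andP [h1 h2] /andP [h3 h4]].
- by rewrite /rk_le !leqnn.
- by apply: rk_inj; lia.
- by rewrite /rk_le; lia.
Qed.

Lemma rk_join x y : exists2 j, is_join le x y j & S j = S x :|: S y.
Proof.
have [||j ej] := @feas_point (maxn (r x) (r y)) (maxn (k x) (k y)).
- by rewrite geq_max !r_le.
- by rewrite geq_max !k_le.
have ej' : S j = S x :|: S y.
  by rewrite ej; apply/setP => t; rewrite !inE !leq_max; do 4!case: (_ < _).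
exists j => //; split; first by rewrite rk_leE ej' subsetUl.
split; first by rewrite rk_leE ej' subsetUr.
by move=> u; rewrite !rk_leE ej' subUset => -> ->.
Qed.

Lemma rk_meet x y : exists m, is_meet le x y m.
Proof.
wlog hr : x y / r x <= r y => [th|].
  case: (leqP (r x) (r y)) => [/th //|/ltnW /th [m [h1 [h2 h3]]]].
  by exists m; do 2!split=> //; move=> u h4 h5; apply: h3.
case: (leqP (k x) (k y)) => [hk|/ltnW hk].
  by exists x; rewrite /is_meet /rk_le hr hk !leqnn.
(* The componentwise minimum is again a point: [k y] is at most [k x], hence at most [a (r x)], and
   it does not occur before [r y], hence not before [r x]. *)
have [|m [e1 e2]] := @rk_ex (r x) (k y).
  case: (rkP x) (rkP y) => [x1 x2 x3] [y1 y2 y3]; split=> //; first exact: leq_trans x2.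
  by move=> t ht; apply: y3; apply: leq_trans hr.
exists m; rewrite /is_meet /rk_le e1 e2 hr hk !leqnn; split=> //; split=> //.
by move=> u /andP [-> _] /andP [_ ->].
Qed.

Lemma rk_lattice : is_lattice le.
Proof.
split; last split; last split; first 2 last.
- by move=> x y; have [j] := rk_join x y; exists j.
- exact: rk_meet.
- have [x _] := @feas_point 0 0 (leq0n _) (leq0n _).
  exact: leq_ltn_trans (leq0n _) (ltn_ord x).
- exact: rk_porder.
Qed.

Lemma rk_S_inj x y : S x = S y -> x = y.
Proof.
by move=> e; case: rk_porder => _ [anti _]; apply: anti; rewrite rk_leE e.
Qed.

(** A strict inclusion can be refined by adding a single position to the smaller set: position [r x]
    if the first component grows, otherwise the new position of least value. *)
Lemma rk_cover_card x y : coversb le x y -> #|S y| = #|S x|.+1.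
Proof.
move=> xy; have nxy := coversb_neq xy; have lxy := coversb_le xy.
suff [t [i [j [tS ih jh es sub]]]] : exists (t : 'I_h) i j,
    [/\ t \notin S x, i <= h, j <= h, feas i j = t |: S x & feas i j \subset S y].
  have [z ez] := feas_point ih jh.
  have xz : le x z by rewrite rk_leE ez es subsetUr.
  have zy : le z y by rewrite rk_leE ez.
  case: (coversb_between xy xz zy) => e; last by rewrite -e ez es cardsU1 tS.
  have ex : S x = t |: S x by rewrite -es -ez e.
  by rewrite ex setU11 in tS.
have [_ ka _] := rkP x.
have [hr|hr] := ltnP (r x) (r y).
  have rh : r x < h by apply: leq_trans hr (r_le y).
  exists (Ordinal rh), (r x).+1, (k x); rewrite k_le rh; split=> //.
  - by rewrite inE /= ltnn /= -leqNgt.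
  - by apply/setP => t; rewrite !inE ltnS leq_eqVlt orbA -(inj_eq val_inj).
  - by case/andP: lxy => _; apply: feas_le.
have er : r x = r y by case/andP: lxy => h1 _; lia.
have /subsetPn [u uS nuS] : ~~ (S y \subset S x).
  apply/negP => s; apply: nxy; apply: rk_S_inj; apply/eqP.
  by rewrite eqEsubset s -rk_leE lxy.
pose P (t : 'I_h) := (t \in S y) && (t \notin S x).
have Pu : P u by rewrite /P uS nuS.
have [t /andP [ts nts] ht] := @arg_minnP _ u P (fun t => a t) Pu.
exists t, (r x), (a t).+1; rewrite nts r_le a_lt //; split=> //.
  apply/setP => v; rewrite !inE ltnS.
  case: (eqVneq v t) => [->|nvt] /=; first by rewrite leqnn orbT.
  case vr: (v < r x) => //=; apply/idP/idP => [vt|vk].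
    rewrite ltnNge; apply/negP => kv.
    have Pv : P v.
      rewrite /P !inE -er vr /= -leqNgt kv andbT.
      move: ts nts; rewrite !inE -er negb_or -!leqNgt => /orP [] h1 /andP [h2 h3]; lia.
    have := ht v Pv => tv; move/eqP: nvt; apply; apply: val_inj.
    by apply: (a_inj (ltn_ord _) (ltn_ord _)); apply/eqP; rewrite eqn_leq vt tv.
  by move: nts; rewrite inE negb_or -!leqNgt; lia.
apply/subsetP => v; rewrite !inE ltnS er; case: (v < r y) => //= vt.
by move: ts nts; rewrite !inE -er negb_or -!leqNgt => /orP [] h1 /andP [h2 h3]; lia.
Qed.

Lemma rk_card_cover x y : le x y -> x <> y -> #|S y| <= #|S x|.+1 -> coversb le x y.
Proof.
have lt_card u v : le u v -> u <> v -> #|S u| < #|S v|.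
  move=> uv nuv; apply: proper_card; rewrite properEneq -rk_leE uv andbT.
  by apply/eqP => /rk_S_inj.
move=> xy nxy hc; apply/coversP; split=> // -[z [[xz nxz] [zy nzy]]].
by have := lt_card _ _ xz nxz; have := lt_card _ _ zy nzy; lia.
Qed.

(** Joins are unions and the set of the meet lies in the intersection, so passing from [v] to the
    join adds at most one position. *)
Lemma rk_semimodular : semimodular le.
Proof.
move=> u v m j [mu [mv hm]] [uj [vj hj]] /coversP mcu.
have [j' [uj' [vj' hj']] ej'] := rk_join u v.
have ej : j = j'.
  by apply: (po_anti rk_porder); [apply: hj | apply: hj'].
subst j'.
have card_j : #|S j| <= #|S v|.+1.
  rewrite ej'; have := cardsUI (S u) (S v); rewrite (rk_cover_card mcu).
  have /subset_leq_card : S m \subset S u :&: S v by rewrite subsetI -!rk_leE mu mv.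
  lia.
have nvj : v <> j.
  move=> e; apply: (coversb_neq mcu); apply: (po_anti rk_porder mu).
  by apply: hm; [apply: po_refl rk_porder _ | rewrite e].
by apply/coversP; apply: rk_card_cover.
Qed.

(** Every element is the join of a prefix of positions and a set of smallest values, so a
    join-irreducible element is of one of these two kinds. Each kind is a chain, and two of any
    three elements share a kind. *)
Lemma rk_slim : slim le.
Proof.
have ji x : join_irr le x -> S x = feas (r x) 0 \/ S x = feas 0 (k x).
  move=> [_ hx].
  have [u eu] := @feas_point (r x) 0 (r_le x) (leq0n _).
  have [v ev] := @feas_point 0 (k x) (leq0n _) (k_le x).
  have [j hj ej] := rk_join u v.
  have ex : j = x.
    apply: rk_S_inj; rewrite ej eu ev; apply/setP => t.
    by rewrite !inE orbF.
  by rewrite ex in hj; case: (hx _ _ hj) => e; [left; rewrite -eu e|right; rewrite -ev e].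
have cmp i i' j j' : feas i j \subset feas i' j' -> forall x y,
    S x = feas i j -> S y = feas i' j' -> le x y by move=> s x y ex ey; rewrite rk_leE ex ey.
have chain x y : S x = feas (r x) 0 -> S y = feas (r y) 0 -> incomparable le x y -> False.
  move=> ex ey [/negP h1 /negP h2]; case/orP: (leq_total (r x) (r y)) => hr.
    by apply: h1; apply: (cmp _ _ _ _ _ _ _ ex ey); apply: feas_le.
  by apply: h2; apply: (cmp _ _ _ _ _ _ _ ey ex); apply: feas_le.
have chain' x y : S x = feas 0 (k x) -> S y = feas 0 (k y) -> incomparable le x y -> False.
  move=> ex ey [/negP h1 /negP h2]; case/orP: (leq_total (k x) (k y)) => hr.
    by apply: h1; apply: (cmp _ _ _ _ _ _ _ ex ey); apply: feas_le.
  by apply: h2; apply: (cmp _ _ _ _ _ _ _ ey ex); apply: feas_le.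
move=> [x [y [z [/ji [] ex [/ji [] ey [/ji [] ez [xy [xz yz]]]]]]]];
  by [apply: (chain x y) | apply: (chain x z) | apply: (chain y z)
     |apply: (chain' x y) | apply: (chain' x z) | apply: (chain' y z)].
Qed.

Definition rk_diagram : ssdiagram n :=
  SSDiagram rk_lattice rk_slim rk_semimodular
    (order_embedding_planar rk_inj rk_lattice (fun x y => erefl)).

(** One cover adds position [i] and raises the first component; another cover would keep that
    component and raise [k], so it is drawn further right. *)
Lemma rk_left_chain i bot top :
  two_covers le bot top (lcov rk_diagram) (rcov rk_diagram) -> i <= h ->
  S (iter i (lcov rk_diagram) bot) = feas i 0.
Proof.
move=> H; elim: i => [|i IH] ih.
  have [o eo] := @feas_point 0 0 (leq0n _) (leq0n _).
  by apply/eqP; rewrite eqEsubset [X in _ && X]feas_le // andbT -eo -rk_leE; apply: (tc_bot H).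
have {IH} := IH (ltnW ih); set x := iter i _ _ => ex.
have rx : r x = i.
  have ix : i <= r x by rewrite -feas_row ?ex // ltnW.
  apply/eqP; rewrite eqn_leq ix andbT leqNgt.
  apply/negP => hi; have : Ordinal ih \in S x by rewrite inE /= hi.
  by rewrite ex inE /= ltnn.
have [z ez] := @feas_point i.+1 0 ih (leq0n _).
have ez' : S z = Ordinal ih |: S x.
  by rewrite ez ex; apply/setP => t; rewrite !inE !orbF ltnS leq_eqVlt -(inj_eq val_inj).
have tx : Ordinal ih \notin S x by rewrite ex inE /= ltnn.
have xz : coversb le x z.
  apply: rk_card_cover; first by rewrite rk_leE ez' subsetUr.
    by move=> e; move: tx; rewrite [in S x]e ez' setU11.
  by rewrite ez' cardsU1 tx.
have nxt : x <> top.
  move=> e; apply: (coversb_neq xz); apply: (po_anti rk_porder (coversb_le xz)).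
  by rewrite e; apply: (tc_top H).
have xw := tc_lc H nxt; rewrite -/x -[iter i.+1 _ _]/(lcov rk_diagram x).
set w := lcov _ x in xw *.
case: (eqVneq w z) => [-> //|/eqP nwz].
have rz : i < r z by rewrite -feas_row // ez.
have rw : r w = i.
  have /andP [hr _] := coversb_le xw.
  apply/eqP; rewrite eqn_leq -{2}rx hr andbT leqNgt; apply/negP => iw.
  apply: nwz; apply/esym; apply: (coversb_le_eq xz xw).
  by rewrite rk_leE ez feas_row.
have kw : k x < k w.
  have /andP [_ hk] := coversb_le xw; rewrite ltn_neqAle hk andbT.
  by apply/eqP => e; apply: (coversb_neq xw); apply: rk_inj; rewrite ?rx ?rw.
have kz : k x <= k z by have /andP [] := coversb_le xz.
case: nwz; suff /leftE [-> //] : leftb rk_diagram x z w.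
apply/leftP; split; [exact/coversP|split; [exact/coversP|]].
rewrite /cross /= rx rw; move: rz kw kz.
move=> /ltP/lt_INR h1 /ltP/lt_INR h2 /leP/le_INR h3; nra.
Qed.

(** By [rk_left_chain] the rows of the diagram are the level sets of [r], and [card_row] reads the
    turns off their sizes. *)
Lemma rk_diagram_code (d : nat -> nat) :
  (forall i, i < h -> #|[set x | r x == i]| = d i) ->
  has_code rk_diagram (rev (mkseq d h)).
Proof.
move=> hd; have [bot [top H]] := diagram_two_covers rk_diagram.
have {}H : two_covers le bot top (lcov rk_diagram) (rcov rk_diagram) by [].
exists bot, top; split=> //; rewrite /strip_code.
have lle i x : i <= h -> le (iter i (lcov rk_diagram) bot) x = (i <= r x).
  by move=> ih; rewrite rk_leE (rk_left_chain H ih) feas_row.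
have eh : lat_length bot top (lcov rk_diagram) = h.
  case: (ltngtP (lat_length bot top (lcov rk_diagram)) h) => // hh.
    have [z ez] := @feas_point h 0 (leqnn h) (leq0n _).
    have := tc_top H z; rewrite rk_leE ez -(iter_lc_length H) (rk_left_chain H (ltnW hh)).
    by move=> /subsetP /(_ (Ordinal hh)); rewrite !inE /= hh ltnn => /(_ isT).
  case: (iter_lc_ntop hh); apply: (top_le H).
  by rewrite rk_leE (rk_left_chain H) //; apply/subsetP => t _; rewrite inE ltn_ord.
rewrite eh; congr rev; rewrite /mkseq; apply/eq_in_map => i; rewrite mem_iota add0n => /andP [_ ih].
have ih' : i < lat_length bot top (lcov rk_diagram) by rewrite eh.
rewrite -(card_row H ih') -hd //; apply: eq_card => x.
by rewrite !inE (lle i x (ltnW ih)) (lle i.+1 x ih) -ltnNge ltnS eqn_leq andbC.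
Qed.

End PermModel.

(** * Permutations from Lehmer codes *)

Section Skip.
Variables (d : nat -> nat).
Hypothesis d_gt0 : forall i, 0 < d i.

(* [skip i] enumerates the naturals other than [(d i).-1]; hence [skips i] enumerates the
   naturals other than [skip_val 0, ..., skip_val i.-1]. *)
Definition skip i j := j + (d i <= j.+1).

Fixpoint skips i j := if i is i'.+1 then skips i' (skip i' j) else j.

Definition skip_val i := skips i (d i).-1.

Lemma skips_mono i : {mono skips i : j j' / j <= j'}.
Proof.
elim: i => [|i IH] j j' //=; rewrite IH /skip; have := d_gt0 i.
by case: (leqP (d i) j.+1); case: (leqP (d i) j'.+1); lia.
Qed.

Lemma skips_inj i : injective (skips i).
Proof. exact: incn_inj (skips_mono i). Qed.

Lemma skips_range i m : (exists j, skips i j = m) <-> forall t, t < i -> skip_val t <> m.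
Proof.
elim: i m => [|i IH] m; first by split=> // _; exists m.
have g0 := d_gt0 i; split=> [[j <-] t|hm].
  rewrite ltnS leq_eqVlt => /orP [/eqP -> /skips_inj|ti]; last first.
    by move: t ti; apply/IH; exists (skip i j).
  by rewrite /skip; case: leqP; lia.
have [|j ej] := (IH m).2; first by move=> t ti; apply: hm; apply: ltnW.
have nj : j <> (d i).-1 by move=> e; apply: (hm i) => //; rewrite /skip_val -e.
have [hj|hj] := ltnP j (d i).-1.
  by exists j; rewrite /= -ej; congr skips; rewrite /skip; case: leqP; lia.
by exists j.-1; rewrite /= -ej; congr skips; rewrite /skip; case: leqP; lia.
Qed.

Lemma skips_top h i : (forall t, t < h -> d t <= h - t) -> i <= h -> skips i (h - i) = h.
Proof.
move=> hd; elim: i => [|i IH] ih /=; first by rewrite subn0.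
rewrite -[RHS](IH (ltnW ih)); congr skips; have := hd i ih.
by rewrite /skip; case: leqP; lia.
Qed.

End Skip.

Lemma has_code_onto n c : 0 < n -> code_valid c -> sumn c = n.-1 ->
  exists E : ssdiagram n, has_code E c.
Proof.
(* The default 1 gives [d h = 1], the row of the top, and keeps [d] positive everywhere. *)
move=> n0 cv cs; pose h := size c; pose d := nth 1 (rev c).
pose sh := rcons (rev c) 1.
have sumsh : sumn sh = n by rewrite sumn_rcons sumn_rev cs; lia.
have sizesh : size sh = h.+1 by rewrite size_rcons size_rev.
have dh : d h = 1 by rewrite /d nth_default // size_rev.
have dsh i : i <= h -> nth 0 sh i = d i.
  rewrite /sh nth_rcons size_rev -/h; case: ltngtP => // [ih _|-> _]; last by rewrite dh.
  by rewrite /d; apply: set_nth_default; rewrite size_rev.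
have dval i : i < h -> 0 < d i <= h - i.
  move=> ih; rewrite /d nth_rev // -/h.
  have ih' : h - i.+1 < size c by rewrite -/h; lia.
  by have := cv _ ih'; rewrite (set_nth_default 1) //; lia.
have d0 i : 0 < d i.
  have [hi|/dval /andP [] //] := leqP h i.
  by rewrite /d nth_default // size_rev.
have dle i : i < h -> d i <= h - i by case/dval/andP.
pose a := skip_val d.
have skips_at i : i < h -> a i < h.
  move=> ih; rewrite -[X in _ < X](skips_top dle (ltnW ih)).
  rewrite /a /skip_val ltnNge skips_mono // -ltnNge.
  by have := dle i ih; have := d0 i; lia.
have ah : a h = h by rewrite -[RHS](skips_top dle (leqnn h)) subnn /a /skip_val dh.
have aneq t t' : t < t' -> a t <> a t'.
  by move=> tt; have [/(_ _) hh _] := skips_range d0 t' (a t'); apply: hh => //; eexists.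
have a_inj t t' : t < h -> t' < h -> a t = a t' -> t = t'.
  by move=> _ _ e; case: (ltngtP t t') => // /aneq; rewrite e.
pose r (x : 'I_n) := reshape_index sh x.
pose k (x : 'I_n) := skips d (r x) (reshape_offset sh x).
have xsh (x : 'I_n) : x < sumn sh by rewrite sumsh.
have rh x : r x <= h by have := reshape_indexP (xsh x); rewrite sizesh.
have offs (x : 'I_n) : reshape_offset sh x < d (r x).
  by rewrite -dsh //; apply: reshape_offsetP.
have rkP x : rk_point h a (r x) (k x).
  split=> //; first by rewrite /k /a /skip_val skips_mono // -ltnS prednK.
  by apply/skips_range => //; eexists.
have cell i j : i <= h -> j < d i -> exists2 x : 'I_n, r x = i & reshape_offset sh x = j.
  move=> ih jd; rewrite -dsh // in jd.
  have xn : flatten_index sh i j < n by rewrite -sumsh; apply: flatten_indexP.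
  exists (Ordinal xn); first exact: flatten_indexKl.
  exact: flatten_indexKr.
have rk_ex i j : rk_point h a i j -> exists x, r x = i /\ k x = j.
  move=> [ih ja /(skips_range d0) [m em]].
  have [|x rx ox] := cell i m ih.
    by move: ja; rewrite -em /a /skip_val skips_mono //; have := d0 i; lia.
  by exists x; rewrite /k ox rx.
have rk_inj x y : r x = r y -> k x = k y -> x = y.
  move=> er; rewrite /k er => /(skips_inj d0) eo; apply: val_inj.
  by rewrite /= -(reshape_indexK sh x) -[RHS](reshape_indexK sh y) eo -/(r x) -/(r y) er.
exists (rk_diagram skips_at ah a_inj rkP rk_ex rk_inj).
have -> : c = rev (mkseq d h).
  rewrite -[LHS]revK; congr rev; rewrite /d /h -(size_rev c); apply/esym.
  exact: mkseq_nth.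
apply: rk_diagram_code => i ih; rewrite -[RHS]card_ord.
pose f (x : 'I_n) : nat := reshape_offset sh x.
have /fin_all_exists [g hg] : forall j : 'I_(d i), exists x : 'I_n, r x = i /\ f x = j.
  by move=> j; have [x h1 h2] := cell i j (ltnW ih) (ltn_ord j); exists x.
have g_inj : injective g.
  by move=> j j' e; apply: val_inj; rewrite /= -(hg j).2 -(hg j').2 e.
rewrite -(card_imset _ g_inj); apply: eq_card => x; rewrite inE.
apply/eqP/imsetP => [rx|[j _ ->]]; last exact: (hg j).1.
have xo : f x < d i by rewrite -rx; apply: offs.
exists (Ordinal xo) => //; apply: rk_inj; first by rewrite (hg _).1.
by rewrite /k (hg _).1 rx -/(f _) -/(f _) (hg _).2.
Qed.

(** * Counting codes *)

(* The ways to distribute [m] further units when the first part has already received [x]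
   units and can receive [b] more, the next part is at most [j.+1], and so on. *)
Fixpoint extensions m x b j : seq (seq nat) :=
  if m is m'.+1 then
    [seq x :: s | s <- extensions m' 1 j j.+1] ++
    (if b is b'.+1 then extensions m' x.+1 b' j else [::])
  else [:: [:: x]].

Fixpoint num_ext m b j : nat :=
  if m is m'.+1 then
    num_ext m' j j.+1 + (if b is b'.+1 then num_ext m' b' j else 0)
  else 1.

Lemma size_extensions m x b j : size (extensions m x b j) = num_ext m b j.
Proof.
elim: m x b j => [|m IH] x b j //=.
by rewrite size_cat size_map IH; case: b => [|b] //; rewrite IH.
Qed.

Definition parts_bounded j (c : seq nat) :=
  forall t, t < size c -> 0 < nth 0 c t <= j + t.

Lemma parts_bounded_cons j y s :
  parts_bounded j (y :: s) <-> 0 < y <= j /\ parts_bounded j.+1 s.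
Proof.
split=> [h|[hy h] [|t] ht] /=.
- split; first by have := h 0 isT; rewrite addn0.
  by move=> t ht; have := h t.+1 ht; rewrite addnS.
- by rewrite addn0.
- by rewrite addnS; apply: h.
Qed.

Lemma mem_extensions m x b j c : 0 < x ->
  (c \in extensions m x b j) <->
  exists y s, [/\ c = y :: s, x <= y <= x + b, y + sumn s = x + m &
                  parts_bounded j.+1 s].
Proof.
elim: m x b j c => [|m IH] x b j c x0 /=.
  rewrite inE; split=> [/eqP ->|[y [s [-> h1 h2 h3]]]].
    by exists x, [::]; split=> //; rewrite ?leqnn ?leq_addr //= addn0.
  case: s h2 h3 => [|z s] h2 h3; last by have /andP [/= h _] := h3 0 isT; move: h2 => /=; lia.
  by rewrite (_ : y = x) //; move: h2 => /=; lia.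
rewrite mem_cat; split=> [/orP [/mapP [s /IH hs ->]|]|[y [s [-> h1 h2 h3]]]].
- have [//|z [s' [es hz1 hz2 hz3]]] := hs.
  exists x, s; rewrite leqnn leq_addr es /=; split=> //; first by lia.
  by apply/parts_bounded_cons; split=> //; lia.
- case: b => [|b] //= /IH [//|y [s [-> h1 h2 h3]]].
  by exists y, s; split=> //; lia.
case: (ltngtP x y) => exy; last first.
- case: s h2 h3 => [|z s] /= h2 h3; first by lia.
  have [hz hs] := (parts_bounded_cons _ _ _).1 h3.
  apply/orP; left; apply/mapP; exists (z :: s); last by rewrite exy.
  by apply/IH => //; exists z, s; split=> //; lia.
- lia.
apply/orP; right; case: b h1 => [|b] h1; first by lia.
by apply/IH => //; exists y, s; split=> //; lia.
Qed.

Lemma uniq_extensions m x b j : 0 < x -> uniq (extensions m x b j).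
Proof.
elim: m x b j => [|m IH] x b j x0 //=.
rewrite cat_uniq map_inj_uniq ?IH //=; last by move=> s s' [].
case: b => [|b] //=; rewrite IH // andbT; apply/hasPn => c.
move=> /mem_extensions [//|y [s [-> h _ _]]].
by apply/mapP => -[s' _ [e _]]; lia.
Qed.

(** Size 0 has no diagram, and the one-element lattice has the empty code. Otherwise the sum is
    [m.+1]: the first part is 1 and can receive nothing more, and [m] units remain. *)
Definition codes n : seq (seq nat) :=
  match n with 0 => [::] | 1 => [:: [::]] | m.+2 => extensions m 1 0 1 end.

Lemma uniq_codes n : uniq (codes n).
Proof. by case: n => [|[|n]] //; apply: uniq_extensions. Qed.

Lemma mem_codes n c : c \in codes n <-> [/\ 0 < n, code_valid c & sumn c = n.-1].
Proof.
have vE : code_valid c <-> parts_bounded 1 c by [].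
case: n => [|[|n]] /=; first by split=> // -[].
  rewrite inE; split=> [/eqP -> //|[_ hv]]; case: c vE hv => //= y s vE hv.
  by have /andP [/= h _] := hv 0 isT; lia.
split=> [/mem_extensions [//|y [s [-> h1 h2 h3]]]|[_ /vE hv]].
  split=> //; suff : parts_bounded 1 (y :: s) by [].
  by apply/parts_bounded_cons; split=> //; lia.
case: c hv {vE} => [|y s] //= /parts_bounded_cons [h1 h2] h3.
by apply/mem_extensions => //; exists y, s; split=> //; lia.
Qed.

Lemma num_ext_double m b j : num_ext m.+1 b j <= 2 * num_ext m b j.
Proof.
elim: m b j => [|m IH] b j; first by rewrite /=; case: b.
have -> k : num_ext k.+1 b j =
    num_ext k j j.+1 + (if b is b'.+1 then num_ext k b' j else 0) by [].
rewrite [num_ext m.+1 b j]/= mulnDr; apply: leq_add; first exact: IH.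
by case: b => [|b] //; apply: IH.
Qed.

Local Open Scope R_scope.

(** A union bound over the [2 ^ m] free placements of the units: [(/ 2) ^ b] bounds the share in
    which the current part overflows, and [2 * (/ 2) ^ j] sums a geometric series bounding the
    shares of the later parts. *)
Lemma num_ext_lower m b j :
  2 ^ m * (1 - (/ 2) ^ b - 2 * (/ 2) ^ j) <= INR (num_ext m b j).
Proof.
have pos k : 0 < (/ 2) ^ k by apply: pow_lt; lra.
elim: m b j => [|m IH] b j; first by have := pos b; have := pos j; rewrite /=; lra.
rewrite [num_ext _ _ _]/= plus_INR; have p2 : 0 < 2 ^ m by apply: pow_lt; lra.
have h1 := IH j j.+1; rewrite [(/ 2) ^ j.+1]/= in h1.
rewrite [2 ^ m.+1]/=; have pj := pos j.
case: b => [|b]; first by rewrite /=; nra.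
by have h2 := IH b j; rewrite [(/ 2) ^ b.+1]/=; nra.
Qed.

Lemma num_ext_limit : exists L, (/ 8 <= L <= 1) /\
  Un_cv (fun m => INR (num_ext m 0 1) / 2 ^ m) L.
Proof.
set u := fun m : nat => _ / _.
have p2 m : 0 < 2 ^ m by apply: pow_lt; lra.
have dec : Un_decreasing u.
  move=> m; rewrite /u; have /leP/le_INR := num_ext_double m 0 1.
  rewrite mult_INR => h; rewrite [2 ^ m.+1]/=.
  apply: (Rmult_le_reg_r (2 * 2 ^ m)); first by have := p2 m; lra.
  have -> : INR (num_ext m 0 1) / 2 ^ m * (2 * 2 ^ m) = INR 2 * INR (num_ext m 0 1).
    by rewrite /=; field; have := p2 m; lra.
  by rewrite /Rdiv Rmult_assoc Rinv_l ?Rmult_1_r //; have := p2 m; lra.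
(* At [(0, 1)] the bound of [num_ext_lower] is negative. Two units later it applies at [(2, 3)] and
   gives half of [2 ^ m], that is, one eighth of [2 ^ m.+2]. *)
have low m : / 8 <= u m.+2.
  have -> : u m.+2 = INR (num_ext m 2 3 + num_ext m 0 2) / (4 * 2 ^ m).
    rewrite /u /= addn0; congr (_ / _); ring.
  apply: (Rmult_le_reg_r (4 * 2 ^ m)); first by have := p2 m; lra.
  rewrite /Rdiv Rmult_assoc Rinv_l; last by have := p2 m; lra.
  rewrite plus_INR; have := num_ext_lower m 2 3; have := pos_INR (num_ext m 0 2).
  by rewrite /=; have := p2 m; lra.
have low' m : / 8 <= u m.
  by have := dec m; have := dec m.+1; have := low m; lra.
have lb : has_lb u.
  by exists (- / 8) => _ [m ->]; rewrite /opp_seq; have := low' m; lra.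
have [L hL] := decreasing_cv _ dec lb.
exists L; split=> //; split.
  apply: (@Rle_cv_lim (fun=> / 8) u) => //.
  by move=> e he; exists 0%nat => m _; rewrite /Rdist Rminus_diag Rabs_R0.
by have := decreasing_ineq _ _ dec hL 0; rewrite /u /=; lra.
Qed.

Local Close Scope R_scope.

Lemma num_ssd_classes_codes n : num_ssd_classes n (size (codes n)).
Proof.
have /fin_all_exists [D hD] : forall i : 'I_(size (codes n)),
    exists E : ssdiagram n, has_code E (nth [::] (codes n) i).
  move=> i; have /mem_codes [n0 cv cs] := mem_nth [::] (ltn_ord i).
  exact: has_code_onto.
exists D; split=> [i j ij|E].
  apply: val_inj; apply/eqP.
  rewrite /= -(nth_uniq [::] (ltn_ord i) (ltn_ord j) (uniq_codes n)); apply/eqP.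
  exact: similar_has_code ij (hD i) (hD j).
have [c [hc cv cs]] := has_code_exists E.
have n0 : 0 < n by case: (d_lattice E).
have /nthP hin : c \in codes n by apply/mem_codes.
have [i ilt e] := hin [::].
exists (Ordinal ilt); apply: (has_code_similar hc).
by have := hD (Ordinal ilt); rewrite /= e.
Qed.

Theorem theorem1p1 :
  exists sigma : nat -> nat,
    (forall n, num_ssd_classes n (sigma n)) /\
    exists C : R, (0 < C < 1)%R /\
      Un_cv (fun n => (INR (sigma n) / pow 2 n)%R) C.
Proof.
exists (fun n => size (codes n)); split; first exact: num_ssd_classes_codes.
have [L [hL cv]] := num_ext_limit.
(* [codes m.+2] has [num_ext m 0 1] entries, while the denominator [2 ^ m.+2] is four times
   [2 ^ m]. *)
exists (L / 4)%R; split; first by lra.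
move=> e he; have [|N hN] := cv (4 * e)%R; first by lra.
exists N.+2 => -[|[|m]] hm; try by lia.
have := hN m; rewrite /Rdist => /(_ ltac:(lia)) h.
have p2 : (0 < 2 ^ m)%R by apply: pow_lt; lra.
rewrite /codes size_extensions.
have -> : (INR (num_ext m 0 1) / 2 ^ m.+2 - L / 4 =
           / 4 * (INR (num_ext m 0 1) / 2 ^ m - L))%R.
  by rewrite /=; field; lra.
by rewrite Rabs_mult (Rabs_pos_eq (/ 4)); lra.
Qed.
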